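(* For $\alpha>0$, $\beta>0$ and $\mu\in\mathbb{R}$, consider the discontinuous piecewise linear vector field on $\mathbb{R}^3$ $$Z_\mu(x,y,z)=\begin{cases}X(x,y,z)=\left(-\alpha,\ x-\beta,\ y-\dfrac{3\beta^2}{8\alpha}\right)&\text{if } z>0,\\[2mm] Y_\mu(x,y,z)=\left(\alpha,\ \dfrac{3\alpha}{\beta}y+\beta,\ \mu+\dfrac{3\beta^2}{8\alpha}\right)&\text{if } z<0,\end{cases}$$ with switching surface $\Sigma=\{z=0\}$. Then, for all positive real numbers $\alpha$ and $\beta$, the following statements hold: (a) For $\mu=0$, the origin $p_0=(0,0,0)$ is a hyperbolic pseudo saddle-focus of $Z_0$, which is an unstable hyperbolic focus of the sliding vector field $\widetilde Z_0$. Moreover, $Z_0$ admits a sliding Shilnikov orbit, connecting $p_0$ to itself, passing through the visible fold-regular point $q_0=\left(\dfrac{3\beta}{2},\dfrac{3\beta^2}{8\alpha},0\right)$. (b) For $\mu\neq0$, $Z_\mu$ does not admit a sliding Shilnikov orbit.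
   Context: Let $Z=(X,Y)$ denote a piecewise vector field with $Z=X$ where $h>0$ and $Z=Y$ where $h<0$; here $h(x,y,z)=z$ and $\Sigma=h^{-1}(0)$. **Regions of $\Sigma$.** Write $Xh(\xi)=\langle\nabla h(\xi),X(\xi)\rangle$ and $(X)^2h=X(Xh)$; similarly for $Y$. On $\Sigma$: the crossing region is $\Sigma^c=\{Xh\cdot Yh>0\}$; the sliding region is $\Sigma^s=\{Xh<0,\ Yh>0\}$; the escaping region is $\Sigma^e=\{Xh>0,\ Yh<0\}$. Points of $\Sigma$ with $Xh=0$ (resp. $Yh=0$) are tangency points of $X$ (resp. $Y$). A tangency point $\xi$ of $X$ (resp. $Y$) is a visible fold of $X$ (resp. $Y$) if $(X)^2h(\xi)>0$ (resp. $(Y)^2h(\xi)<0$). A visible fold $\xi\in\partial\Sigma^s$ of $X$ (resp. $Y$) is a visible fold-regular point if $Yh(\xi)>0$ (resp. $Xh(\xi)<0$); a visible fold $\xi\in\partial\Sigma^e$ of $X$ (resp. $Y$) is a visible fold-regular point if $Yh(\xi)<0$ (resp. $Xh(\xi)>0$). **Sliding vector field.** On $\Sigma^s\cup\Sigma^e$, $$\widetilde Z(\xi)=\frac{Yh(\xi)X(\xi)-Xh(\xi)Y(\xi)}{Yh(\xi)-Xh(\xi)}.$$ It is tangent to $\Sigma$ and is regarded as a planar vector field; $\widetilde Z_0$ is the sliding vector field of $Z_0=(X,Y_0)$. **Filippov trajectories.** $\varphi_V(t,\xi)$ denotes the trajectory of a vector field $V$ with $\varphi_V(0,\xi)=\xi$.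 The local trajectory $\varphi_Z(t,\xi)$ of $Z$ is: (i) $\varphi_X$ if $h(\xi)>0$ and $\varphi_Y$ if $h(\xi)<0$; (ii) if $\xi\in\Sigma^c$ with $Xh(\xi),Yh(\xi)>0$: $\varphi_Y$ for $t<0$ and $\varphi_X$ for $t>0$ (if $Xh(\xi),Yh(\xi)<0$, the same with time reversed); (iii) if $\xi\in\Sigma^s$: $\varphi_{\widetilde Z}$ for $t\ge0$, and any one of $\varphi_X,\varphi_Y,\varphi_{\widetilde Z}$ for $t\le0$ (for $\xi\in\Sigma^e$, the same with time reversed); (iv) if $\xi\in\partial\Sigma^s$ is a visible fold-regular point which is a fold of $X$: any one of $\varphi_X,\varphi_Y,\varphi_{\widetilde Z}$ for $t\le 0$, and $\varphi_X$ for $t\ge0$ (analogously for a fold of $Y$; for $\partial\Sigma^e$, with time reversed). A trajectory of $Z$ is a concatenation of such local trajectories. **Hyperbolic pseudo saddle-focus.** A point $\xi^*\in\Sigma^s$ (resp. $\xi^*\in\Sigma^e$) with $\widetilde Z(\xi^* )=0$ is a pseudo equilibrium; it is a hyperbolic pseudo saddle-focus if it is an unstable (resp. stable) hyperbolic focus of $\widetilde Z$. **Sliding Shilnikov orbit.** Let $p\in\Sigma^s$ (resp. $p\in\Sigma^e$) be a hyperbolic pseudo saddle-focus of $Z$ and let $q\in\partial\Sigma^s$ (resp. $q\in\partial\Sigma^e$) be a visible fold-regular point of $Z$ such that: (j) the backward (resp. forward) trajectory of $Z$ starting at $q$ that follows the sliding vector field $\widetilde Z$ converges to $p$ backward (resp.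 forward) in time; (jj) the forward (resp. backward) trajectory of $Z$ starting at $q$ intersects $\Sigma$ (strictly between $q$ and $p$) only at crossing points and reaches $p$ in finite time $t_0>0$ (resp. $t_0<0$). The resulting closed loop $\Gamma$ through $p$ and $q$ is called a sliding Shilnikov orbit (connecting $p$ to itself and passing through $q$). *)

(* Defs.v *)
(* Stdlib reals with Coquelicot. *)
From Stdlib Require Import Reals.
From Coquelicot Require Import Coquelicot.
Open Scope R_scope.

(* Points are ((x, y), z), so that [fst] is the projection onto the (x, y)-plane. *)
Notation R2 := (R * R)%type.
Notation R3 := (R * R * R)%type.

Record pwfield := PW { upper : R3 -> R3 ; lower : R3 -> R3 }.

Definition h (xi : R3) : R := snd xi.

Definition grad (f : R3 -> R) (xi : R3) : R3 :=
  let '(x, y, z) := xi in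
  (Derive (fun s => f (s, y, z)) x,
   Derive (fun s => f (x, s, z)) y,
   Derive (fun s => f (x, y, s)) z).

Definition dot (u v : R3) : R :=
  let '(u1, u2, u3) := u in
  let '(v1, v2, v3) := v in
  u1 * v1 + u2 * v2 + u3 * v3.

Definition lie (V : R3 -> R3) (f : R3 -> R) (xi : R3) : R :=
  dot (grad f xi) (V xi).

Section Filippov.

Variable Z : pwfield.
Local Notation X := (upper Z).
Local Notation Y := (lower Z).

Definition Sigma (xi : R3) : Prop := h xi = 0.

Definition crossing_up (xi : R3) : Prop :=
  Sigma xi /\ lie X h xi > 0 /\ lie Y h xi > 0.
Definition crossing_down (xi : R3) : Prop :=
  Sigma xi /\ lie X h xi < 0 /\ lie Y h xi < 0.
Definition crossing (xi : R3) : Prop :=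
  Sigma xi /\ lie X h xi * lie Y h xi > 0.
Definition sliding (xi : R3) : Prop :=
  Sigma xi /\ lie X h xi < 0 /\ lie Y h xi > 0.
Definition escaping (xi : R3) : Prop :=
  Sigma xi /\ lie X h xi > 0 /\ lie Y h xi < 0.

Definition closure (A : R3 -> Prop) (xi : R3) : Prop :=
  forall eps : posreal, exists eta, ball xi eps eta /\ A eta.

(* Boundary relative to Sigma: a subset of the plane Sigma has empty interior
   in the ambient space. *)
Definition boundary (A : R3 -> Prop) (xi : R3) : Prop :=
  Sigma xi /\ closure A xi /\ closure (fun eta => Sigma eta /\ ~ A eta) xi.

Definition visible_fold_X (xi : R3) : Prop :=
  Sigma xi /\ lie X h xi = 0 /\ lie X (lie X h) xi > 0.
Definition visible_fold_Y (xi : R3) : Prop :=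
  Sigma xi /\ lie Y h xi = 0 /\ lie Y (lie Y h) xi < 0.

Definition fold_regular_sliding_X (xi : R3) : Prop :=
  boundary sliding xi /\ visible_fold_X xi /\ lie Y h xi > 0.
Definition fold_regular_sliding_Y (xi : R3) : Prop :=
  boundary sliding xi /\ visible_fold_Y xi /\ lie X h xi < 0.
Definition fold_regular_escaping_X (xi : R3) : Prop :=
  boundary escaping xi /\ visible_fold_X xi /\ lie Y h xi < 0.
Definition fold_regular_escaping_Y (xi : R3) : Prop :=
  boundary escaping xi /\ visible_fold_Y xi /\ lie X h xi > 0.

Definition fold_regular_sliding (xi : R3) : Prop :=
  fold_regular_sliding_X xi \/ fold_regular_sliding_Y xi.
Definition fold_regular_escaping (xi : R3) : Prop :=
  fold_regular_escaping_X xi \/ fold_regular_escaping_Y xi.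
Definition visible_fold_regular (xi : R3) : Prop :=
  fold_regular_sliding xi \/ fold_regular_escaping xi.

(* Meaningful where lie Y h <> lie X h, in particular on the sliding and
   escaping regions and at fold-regular points. *)
Definition sliding_field (xi : R3) : R3 :=
  scal (/ (lie Y h xi - lie X h xi))
       (minus (scal (lie Y h xi) (X xi)) (scal (lie X h xi) (Y xi))).

(* The sliding field read in the coordinates (x, y) of Sigma. *)
Definition planar_sliding_field (w : R2) : R2 := fst (sliding_field (w, 0)).

Definition follows (V : R3 -> R3) (gamma : R -> R3) (I : R -> Prop) : Prop :=
  forall t, I t -> is_derive gamma t (V (gamma t)).

Definition slides (gamma : R -> R3) (I : R -> Prop) : Prop :=
  (forall t, I t -> sliding (gamma t) \/ escaping (gamma t)) /\
  follows sliding_field gamma I.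

(* The local trajectory of Z at xi = gamma t, for the times just after t
   ([local_forward]) and just before t ([local_backward]).  The equation is
   imposed on an open interval ending at t; continuity at t is required
   in [trajectory]. *)
Definition local_forward (gamma : R -> R3) (t : R) : Prop :=
  exists eps : posreal,
  let I := fun s => t < s < t + eps in
  let xi := gamma t in
  (h xi > 0 /\ follows X gamma I) \/
  (h xi < 0 /\ follows Y gamma I) \/
  (crossing_up xi /\ follows X gamma I) \/
  (crossing_down xi /\ follows Y gamma I) \/
  (sliding xi /\ slides gamma I) \/
  (escaping xi /\ (follows X gamma I \/ follows Y gamma I \/ slides gamma I)) \/
  (fold_regular_sliding_X xi /\ follows X gamma I) \/
  (fold_regular_sliding_Y xi /\ follows Y gamma I) \/
  (fold_regular_escaping xi /\
     (follows X gamma I \/ follows Y gamma I \/ slides gamma I)).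

Definition local_backward (gamma : R -> R3) (t : R) : Prop :=
  exists eps : posreal,
  let I := fun s => t - eps < s < t in
  let xi := gamma t in
  (h xi > 0 /\ follows X gamma I) \/
  (h xi < 0 /\ follows Y gamma I) \/
  (crossing_up xi /\ follows Y gamma I) \/
  (crossing_down xi /\ follows X gamma I) \/
  (escaping xi /\ slides gamma I) \/
  (sliding xi /\ (follows X gamma I \/ follows Y gamma I \/ slides gamma I)) \/
  (fold_regular_escaping_X xi /\ follows X gamma I) \/
  (fold_regular_escaping_Y xi /\ follows Y gamma I) \/
  (fold_regular_sliding xi /\
     (follows X gamma I \/ follows Y gamma I \/ slides gamma I)).

(* A trajectory of Z on [a, b]: by compactness, the local conditions say that
   gamma is a finite concatenation of local trajectories. *)
Definition trajectory (gamma : R -> R3) (a b : R) : Prop :=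
  continuous_on (fun t => a <= t <= b) gamma /\
  (forall t, a <= t < b -> local_forward gamma t) /\
  (forall t, a < t <= b -> local_backward gamma t).

End Filippov.

(* lambda is an eigenvalue of the real matrix ((a, b), (c, d)) over C. *)
Definition eigenvalue2 (a b c d : R) (lambda : C) : Prop :=
  exists u v : C,
    (u, v) <> (RtoC 0, RtoC 0) /\
    (RtoC a * u + RtoC b * v = lambda * u)%C /\
    (RtoC c * u + RtoC d * v = lambda * v)%C.

(* p is an equilibrium of the planar field F whose linearization has only
   non-real eigenvalues, with real parts satisfying P. *)
Definition focus_with (P : R -> Prop) (F : R2 -> R2) (p : R2) : Prop :=
  F p = (0, 0) /\
  exists a b c d : R,
    filterdiff F (locally p)
      (fun w => (a * fst w + b * snd w, c * fst w + d * snd w)) /\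
    forall lambda : C, eigenvalue2 a b c d lambda ->
      Im lambda <> 0 /\ P (Re lambda).

Definition unstable_hyperbolic_focus := focus_with (fun r => r > 0).
Definition stable_hyperbolic_focus := focus_with (fun r => r < 0).

Definition pseudo_equilibrium (Z : pwfield) (p : R3) : Prop :=
  (sliding Z p \/ escaping Z p) /\ sliding_field Z p = (0, 0, 0).

Definition hyperbolic_pseudo_saddle_focus (Z : pwfield) (p : R3) : Prop :=
  pseudo_equilibrium Z p /\
  ((sliding Z p /\
      unstable_hyperbolic_focus (planar_sliding_field Z) (fst p)) \/
   (escaping Z p /\
      stable_hyperbolic_focus (planar_sliding_field Z) (fst p))).

Definition shilnikov_orbit_sliding (Z : pwfield) (p q : R3) (Gamma : R3 -> Prop) :=
  sliding Z p /\ hyperbolic_pseudo_saddle_focus Z p /\ fold_regular_sliding Z q /\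
  exists (g1 g2 : R -> R3) (t0 : R),
    (g1 0 = q /\
     continuous_on (fun t => t <= 0) g1 /\
     slides Z g1 (fun t => t < 0) /\
     filterlim g1 (Rbar_locally m_infty) (locally p)) /\
    (t0 > 0 /\ g2 0 = q /\ g2 t0 = p /\
     trajectory Z g2 0 t0 /\
     (forall t, 0 < t < t0 -> Sigma (g2 t) -> crossing Z (g2 t))) /\
    (forall xi, Gamma xi <->
       xi = p \/ (exists t, t <= 0 /\ xi = g1 t) \/
       (exists t, 0 <= t <= t0 /\ xi = g2 t)).

Definition shilnikov_orbit_escaping (Z : pwfield) (p q : R3) (Gamma : R3 -> Prop) :=
  escaping Z p /\ hyperbolic_pseudo_saddle_focus Z p /\ fold_regular_escaping Z q /\
  exists (g1 g2 : R -> R3) (t0 : R),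
    (g1 0 = q /\
     continuous_on (fun t => 0 <= t) g1 /\
     slides Z g1 (fun t => 0 < t) /\
     filterlim g1 (Rbar_locally p_infty) (locally p)) /\
    (t0 < 0 /\ g2 0 = q /\ g2 t0 = p /\
     trajectory Z g2 t0 0 /\
     (forall t, t0 < t < 0 -> Sigma (g2 t) -> crossing Z (g2 t))) /\
    (forall xi, Gamma xi <->
       xi = p \/ (exists t, 0 <= t /\ xi = g1 t) \/
       (exists t, t0 <= t <= 0 /\ xi = g2 t)).

(* Gamma is a sliding Shilnikov orbit connecting p to itself through q. *)
Definition sliding_shilnikov_orbit (Z : pwfield) (p q : R3) (Gamma : R3 -> Prop) :=
  shilnikov_orbit_sliding Z p q Gamma \/ shilnikov_orbit_escaping Z p q Gamma.

Definition admits_sliding_shilnikov_orbit (Z : pwfield) : Prop :=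
  exists (p q : R3) (Gamma : R3 -> Prop), sliding_shilnikov_orbit Z p q Gamma.

Definition Xfield (alpha beta : R) (xi : R3) : R3 :=
  let '(x, y, z) := xi in
  (- alpha, x - beta, y - 3 * beta ^ 2 / (8 * alpha)).

Definition Yfield (alpha beta mu : R) (xi : R3) : R3 :=
  let '(x, y, z) := xi in
  (alpha, 3 * alpha / beta * y + beta, mu + 3 * beta ^ 2 / (8 * alpha)).

Definition Zfield (alpha beta mu : R) : pwfield :=
  PW (Xfield alpha beta) (Yfield alpha beta mu).

(* Main.v *)
Require Import Defs.
From Stdlib Require Import Reals Lra Psatz.
From Coquelicot Require Import Coquelicot.
Open Scope R_scope.

(* For z > 0 the orbits are explicit cubics.  The X-orbit of a visible fold
   (xq, c, 0), c = 3 beta^2 / (8 alpha), returns to Sigma at a sliding point, so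
   a sliding Shilnikov orbit requires this point to be the pseudo equilibrium
   (3 alpha mu / beta, - mu, 0); this is a quadratic equation in xq - beta whose
   only positive root beta / 2 forces mu = 0.  In the escaping case the backward
   X-orbit of the fold never returns.

   For mu = 0, put x = beta u and y = c v.  Up to a constant, the backward
   sliding flow is
     u' = 3 v / (2 - v),   v' = - (8 u + v - 9 v^2) / (2 - v),
   started at (3/2, 1), and E = exp (-6 u) (v^2 - 8 u / 9 - 4/27) satisfies
   E' = - 2 v^2 exp (-6 u) / (2 - v).  The sublevel set of E through (3/2, 1) is
   bounded, and the orbit can leave the sliding region v < 1 only at a point
   (u, 1) with u <= 1, where E >= - exp (-6) / 27.  To get there it must first
   cross the strip 0 <= u <= 1 from right to left, which costs more energy than
   that.  Finally E + 4/27 + eps u v, with eps small, is a strict Lyapunov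
   function comparable to u^2 + v^2, so the orbit converges to the origin. *)

(** * Picard iteration for a bounded Lipschitz planar field *)

(** The sequences [a n - 2 * C * (/ 2) ^ n] and [a n + 2 * C * (/ 2) ^ n] are adjacent and monotone,
    so they enclose the limit of [a] at every index. *)
Lemma geometric_cauchy (a : nat -> R) (C : R) :
  (forall n, Rabs (a (S n) - a n) <= C * (/ 2) ^ n) ->
  forall n, Rabs (real (Lim_seq a) - a n) <= 2 * C * (/ 2) ^ n.
Proof.
intros Ha.
set (lo := fun n => a n - 2 * C * (/ 2) ^ n).
set (hi := fun n => a n + 2 * C * (/ 2) ^ n).
assert (Hlo : forall n, lo n <= lo (S n)).
{ intros n; unfold lo; simpl; specialize (Ha n).
  apply Rabs_le_between in Ha; lra. }
assert (Hhi : forall n, hi (S n) <= hi n).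
{ intros n; unfold hi; simpl; specialize (Ha n).
  apply Rabs_le_between in Ha; lra. }
assert (Hpow : is_lim_seq (fun n => 2 * C * (/ 2) ^ n) 0).
{ replace (Finite 0) with (Rbar_mult (2 * C) 0) by (simpl; f_equal; ring).
  apply is_lim_seq_scal_l, is_lim_seq_geom.
  rewrite Rabs_pos_eq; lra. }
assert (Hdiff : is_lim_seq (fun n => hi n - lo n) 0).
{ apply is_lim_seq_ext with (fun n => 2 * C * (/ 2) ^ n + 2 * C * (/ 2) ^ n).
  - intros n; unfold hi, lo; ring.
  - replace 0 with (0 + 0) by ring.
    now apply is_lim_seq_plus'. }
destruct (ex_lim_seq_adj lo hi Hlo Hhi Hdiff) as [[l Hl] [[l' Hl'] Heq]].
rewrite (is_lim_seq_unique _ _ Hl), (is_lim_seq_unique _ _ Hl') in Heq.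
injection Heq as <-.
assert (Hlim : is_lim_seq a l).
{ apply is_lim_seq_ext with (fun n => lo n + 2 * C * (/ 2) ^ n).
  - intros n; unfold lo; ring.
  - replace l with (l + 0) by ring.
    now apply is_lim_seq_plus'. }
rewrite (is_lim_seq_unique _ _ Hlim); simpl.
intros n.
pose proof (is_lim_seq_incr_compare lo l Hl Hlo n) as H1.
pose proof (is_lim_seq_decr_compare hi l Hl' Hhi n) as H2.
unfold lo, hi in *; apply Rabs_le; lra.
Qed.

Lemma vanishing_bound (a K : R) : (forall n, Rabs a <= K * (/ 2) ^ n) -> a = 0.
Proof.
intros H.
assert (Hlim : is_lim_seq (fun n => K * (/ 2) ^ n) 0).
{ replace (Finite 0) with (Rbar_mult K 0) by (simpl; f_equal; ring).
  apply is_lim_seq_scal_l, is_lim_seq_geom; rewrite Rabs_pos_eq; lra. }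
pose proof (is_lim_seq_le _ _ _ _ H (is_lim_seq_const (Rabs a)) Hlim) as Hle.
simpl in Hle; destruct (Req_dec a 0) as [-> | Hne]; [easy |].
pose proof (Rabs_pos_lt a Hne); lra.
Qed.

Lemma is_RInt_continuous (f : R -> R) (a b : R) :
  (forall t, continuous f t) -> is_RInt f a b (RInt f a b).
Proof.
intros Hf; apply (RInt_correct (V := R_CompleteNormedModule)).
apply (ex_RInt_continuous (V := R_CompleteNormedModule)); auto.
Qed.

Lemma is_derive_RInt_continuous (f : R -> R) (t : R) :
  (forall s, continuous f s) -> is_derive (fun s => RInt f 0 s) t (f t).
Proof.
intros Hf; apply (is_derive_RInt f _ 0); auto.
apply filter_forall; intros s; now apply is_RInt_continuous.
Qed.

(** Integration against a weight of rate [lam] gains a factor [/ lam]. This gain makes the Picard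
    operator contract on the whole line, without restriction to a short time interval. *)
Lemma RInt_exp_bound (f : R -> R) (K lam t : R) :
  0 < lam -> (forall s, continuous f s) ->
  (forall s, Rabs (f s) <= K * exp (lam * Rabs s)) ->
  Rabs (RInt f 0 t) <= K / lam * exp (lam * Rabs t).
Proof.
intros Hlam Hf Hb.
assert (HK : 0 <= K).
{ specialize (Hb 0); rewrite Rabs_R0, Rmult_0_r, exp_0 in Hb.
  pose proof (Rabs_pos (f 0)); lra. }
assert (Hexp : forall c a b, c <> 0 -> is_RInt (fun s => K * exp (c * s)) a b
                 (K / c * exp (c * b) - K / c * exp (c * a))).
{ intros c a b Hc.
  apply (is_RInt_derive (fun s => K / c * exp (c * s))).
  - intros s _; auto_derive; [trivial | now field].
  - intros s _; apply (ex_derive_continuous (fun s => K * exp (c * s))).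
    auto_derive; trivial. }
destruct (Rle_dec 0 t) as [Ht | Ht].
- eapply Rle_trans.
  + apply (norm_RInt_le f (fun s => K * exp (lam * s)) 0 t); auto.
    * intros s Hs; specialize (Hb s); rewrite (Rabs_pos_eq s) in Hb; [apply Hb | lra].
    * now apply is_RInt_continuous.
    * apply Hexp; lra.
  + rewrite (Rabs_pos_eq t) by lra; rewrite Rmult_0_r, exp_0.
    assert (0 <= K / lam) by (apply Rdiv_le_0_compat; lra); lra.
- rewrite <- (opp_RInt_swap (V := R_CompleteNormedModule)); cycle 1.
  { eexists; now apply is_RInt_continuous. }
  change (opp (RInt f t 0)) with (- RInt f t 0); rewrite Rabs_Ropp.
  eapply Rle_trans.
  + apply (norm_RInt_le f (fun s => K * exp (- lam * s)) t 0); [lra | | |].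
    * intros s Hs; specialize (Hb s); rewrite (Rabs_left1 s) in Hb by lra.
      replace (- lam * s) with (lam * - s) by ring; apply Hb.
    * now apply is_RInt_continuous.
    * apply Hexp; lra.
  + rewrite (Rabs_left1 t) by lra; rewrite Rmult_0_r, exp_0.
    replace (- lam * t) with (lam * - t) by ring.
    assert (0 <= K / lam) by (apply Rdiv_le_0_compat; lra).
    replace (K / - lam) with (- (K / lam)) by (field; lra); lra.
Qed.

Section Picard.

Variables (F : bool -> R -> R -> R) (L B : R) (x0 : bool -> R).
Hypothesis L_pos : 0 < L.
Hypothesis F_bounded : forall i u v, Rabs (F i u v) <= B.
Hypothesis F_lipschitz : forall i u v u' v',
  Rabs (F i u v - F i u' v') <= L * (Rabs (u - u') + Rabs (v - v')).

(** The Boolean selects the component, [true] for the first and [false] for the second, so that each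
    estimate is proved once for both. *)
Fixpoint picard (n : nat) (i : bool) (t : R) : R :=
  match n with
  | O => x0 i
  | S m => x0 i + RInt (fun s => F i (picard m true s) (picard m false s)) 0 t
  end.

Lemma continuous_field (i : bool) (u v : R -> R) (t : R) :
  continuous u t -> continuous v t -> continuous (fun s => F i (u s) (v s)) t.
Proof.
intros Hu Hv; apply filterlim_locally; intros eps.
assert (He : 0 < eps / (2 * L)) by (apply Rdiv_lt_0_compat; [apply eps | lra]).
pose proof (proj1 (filterlim_locally _ _) Hu (mkposreal _ He)) as H1.
pose proof (proj1 (filterlim_locally _ _) Hv (mkposreal _ He)) as H2.
generalize (filter_and _ _ H1 H2); apply filter_imp; intros s [Hs1 Hs2].
change (Rabs (u s - u t) < eps / (2 * L)) in Hs1.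
change (Rabs (v s - v t) < eps / (2 * L)) in Hs2.
change (Rabs (F i (u s) (v s) - F i (u t) (v t)) < eps).
eapply Rle_lt_trans; [apply F_lipschitz |].
replace (pos eps) with (L * (eps / (2 * L) + eps / (2 * L))) by (field; lra).
apply Rmult_lt_compat_l; lra.
Qed.

Lemma picard_continuous (n : nat) (i : bool) (t : R) : continuous (picard n i) t.
Proof.
revert i t; induction n as [| n IH]; intros i t; simpl.
- apply continuous_const.
- apply (continuous_plus (fun _ => x0 i)); [apply continuous_const |].
  apply (ex_derive_continuous (V := R_NormedModule)
    (fun r => RInt (fun s => F i (picard n true s) (picard n false s)) 0 r)).
  eexists; apply is_derive_RInt_continuous.
  intros s; now apply continuous_field.
Qed.

Lemma picard_derive (n : nat) (i : bool) (t : R) :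
  is_derive (picard (S n) i) t (F i (picard n true t) (picard n false t)).
Proof.
simpl.
replace (F i (picard n true t) (picard n false t))
  with (0 + F i (picard n true t) (picard n false t)) by ring.
apply (is_derive_plus (fun _ => x0 i)); [apply (is_derive_const (x0 i) t) |].
apply (is_derive_RInt_continuous (fun s => F i (picard n true s) (picard n false s))).
intros s; apply continuous_field; apply picard_continuous.
Qed.

(** The constant does not depend on [n], so the bound survives in the limit and yields its
    continuity. *)
Lemma picard_lipschitz (n : nat) (i : bool) (s t : R) :
  Rabs (picard n i t - picard n i s) <= B * Rabs (t - s).
Proof.
destruct n as [| n].
- simpl; rewrite Rminus_diag, Rabs_R0.
  apply Rmult_le_pos; [| apply Rabs_pos].
  eapply Rle_trans; [apply Rabs_pos | apply (F_bounded true 0 0)].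
- apply (bounded_variation _ (fun r => F i (picard n true r) (picard n false r))).
  intros r _; split; [apply picard_derive | apply F_bounded].
Qed.

(** The size of the first Picard step: a field bounded by [B], integrated against the weight of rate
    [4 * L]. *)
Let C := B / (4 * L).

(* With the weight exp (4 L |t|) the Picard operator is a contraction of ratio 1/2. *)
Lemma picard_step (n : nat) (i : bool) (t : R) :
  Rabs (picard (S n) i t - picard n i t) <= C * exp (4 * L * Rabs t) * (/ 2) ^ n.
Proof.
revert i t; induction n as [| n IH]; intros i t.
- assert (E : picard 1 i t - picard 0 i t = RInt (fun s => F i (x0 true) (x0 false)) 0 t)
    by (simpl; ring).
  rewrite E; simpl; rewrite Rmult_1_r; apply RInt_exp_bound; [lra | |].
  + intros s; apply continuous_const.
  + intros s; eapply Rle_trans; [apply F_bounded |].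
    assert (0 <= B) by (eapply Rle_trans; [apply Rabs_pos | apply (F_bounded true 0 0)]).
    rewrite <- (Rmult_1_r B) at 1; apply Rmult_le_compat_l; [lra |].
    rewrite <- exp_0; pose proof (Rabs_pos s).
    destruct (Req_dec (4 * L * Rabs s) 0) as [-> | Hne]; [lra |].
    left; apply exp_increasing; nra.
- set (f := fun m s => F i (picard m true s) (picard m false s)).
  assert (Hf : forall m s, continuous (f m) s).
  { intros m s; apply continuous_field; apply picard_continuous. }
  replace (picard (S (S n)) i t - picard (S n) i t)
    with (RInt (fun s => f (S n) s - f n s) 0 t).
  2:{ change (picard (S (S n)) i t - picard (S n) i t)
        with ((x0 i + RInt (f (S n)) 0 t) - (x0 i + RInt (f n) 0 t)).
      rewrite (RInt_minus (V := R_CompleteNormedModule));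
        [| eexists; apply is_RInt_continuous, Hf ..].
      unfold minus, plus, opp; simpl; ring. }
  eapply Rle_trans.
  + apply (RInt_exp_bound _ (2 * L * C * (/ 2) ^ n) (4 * L)); [lra | |].
    * intros s; apply (continuous_minus (f (S n)) (f n)); apply Hf.
    * intros s; eapply Rle_trans; [apply F_lipschitz |].
      pose proof (IH true s) as H1; pose proof (IH false s) as H2.
      eapply Rle_trans; [apply Rmult_le_compat_l;
        [lra | apply Rplus_le_compat; [apply H1 | apply H2]] |].
      right; ring.
  + right; simpl; field; lra.
Qed.

Let x (i : bool) (t : R) : R := real (Lim_seq (fun n => picard n i t)).

Lemma picard_limit (n : nat) (i : bool) (t : R) :
  Rabs (x i t - picard n i t) <= 2 * (C * exp (4 * L * Rabs t)) * (/ 2) ^ n.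
Proof.
apply (geometric_cauchy (fun n => picard n i t)); intros m; apply picard_step.
Qed.

Lemma limit_continuous (i : bool) (t : R) : continuous (x i) t.
Proof.
assert (B_pos : 0 <= B) by (eapply Rle_trans; [apply Rabs_pos | apply (F_bounded true 0 0)]).
assert (Hlip : forall s, Rabs (x i s - x i t) <= B * Rabs (s - t)).
{ intros s; apply Rnot_lt_le; intros Hlt.
  (* The excess [d] over the Lipschitz bound is at most [K * (/ 2) ^ n] for every [n], because the
     iterates satisfy that bound; hence it vanishes. *)
  set (d := Rabs (x i s - x i t) - B * Rabs (s - t)).
  set (K := 2 * (C * exp (4 * L * Rabs s)) + 2 * (C * exp (4 * L * Rabs t))).
  assert (d = 0); [| unfold d in *; lra].
  apply (vanishing_bound d K); intros n.
  rewrite Rabs_pos_eq by (unfold d; lra).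
  pose proof (picard_limit n i s) as H1; pose proof (picard_limit n i t) as H2.
  pose proof (picard_lipschitz n i t s) as H3.
  pose proof (Rabs_triang (x i s - picard n i s)
    ((picard n i s - picard n i t) - (x i t - picard n i t))) as H4.
  pose proof (Rabs_triang (picard n i s - picard n i t) (- (x i t - picard n i t))) as H5.
  rewrite Rabs_Ropp in H5.
  replace (x i s - picard n i s + (picard n i s - picard n i t - (x i t - picard n i t)))
    with (x i s - x i t) in H4 by ring.
  unfold d, K, Rminus in *; lra. }
apply filterlim_locally; intros eps.
assert (He : 0 < eps / (B + 1)) by (apply Rdiv_lt_0_compat; [apply eps | lra]).
exists (mkposreal _ He); intros s Hs.
change (Rabs (s - t) < eps / (B + 1)) in Hs.
change (Rabs (x i s - x i t) < eps).
eapply Rle_lt_trans; [apply Hlip |].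
apply Rle_lt_trans with ((B + 1) * Rabs (s - t)).
- pose proof (Rabs_pos (s - t)); nra.
- replace (pos eps) with ((B + 1) * (eps / (B + 1))) by (field; lra).
  apply Rmult_lt_compat_l; lra.
Qed.

(** Both sides are within a multiple of [(/ 2) ^ n] of the iterate of index [S n], and [n] is
    arbitrary. *)
Lemma limit_integral_equation (i : bool) (t : R) :
  x i t = x0 i + RInt (fun s => F i (x true s) (x false s)) 0 t.
Proof.
set (f := fun s => F i (x true s) (x false s)).
set (g := fun n s => F i (picard n true s) (picard n false s)).
assert (Hf : forall s, continuous f s).
{ intros s; apply continuous_field; apply limit_continuous. }
assert (Hg : forall n s, continuous (g n) s).
{ intros n s; apply continuous_field; apply picard_continuous. }
apply Rminus_diag_uniq.
apply (vanishing_bound _ (2 * (C * exp (4 * L * Rabs t)))); intros n.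
replace (x i t - (x0 i + RInt f 0 t))
  with ((x i t - picard (S n) i t) - RInt (fun s => f s - g n s) 0 t).
2:{ rewrite (RInt_minus (V := R_CompleteNormedModule) f (g n));
      [| eexists; apply is_RInt_continuous; auto ..].
    change (picard (S n) i t) with (x0 i + RInt (g n) 0 t).
    unfold minus, plus, opp; simpl; ring. }
eapply Rle_trans; [apply Rabs_triang |]; rewrite Rabs_Ropp.
pose proof (picard_limit (S n) i t) as H1.
assert (H2 : Rabs (RInt (fun s => f s - g n s) 0 t) <=
             4 * L * C * (/ 2) ^ n / (4 * L) * exp (4 * L * Rabs t)).
{ apply RInt_exp_bound; [lra | |].
  - intros s; apply (continuous_minus f (g n)); auto.
  - intros s; eapply Rle_trans; [apply F_lipschitz |].
    pose proof (picard_limit n true s) as H2; pose proof (picard_limit n false s) as H3.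
    eapply Rle_trans; [apply Rmult_le_compat_l;
        [lra | apply Rplus_le_compat; [apply H2 | apply H3]] |].
    right; ring. }
cbn [pow] in H1.
replace (4 * L * C * (/ 2) ^ n / (4 * L) * exp (4 * L * Rabs t))
  with (C * (/ 2) ^ n * exp (4 * L * Rabs t)) in H2 by (field; lra).
lra.
Qed.

Lemma planar_ode_solution :
  exists u v : R -> R, u 0 = x0 true /\ v 0 = x0 false /\
  (forall t, is_derive u t (F true (u t) (v t))) /\
  (forall t, is_derive v t (F false (u t) (v t))).
Proof.
assert (Hder : forall i t, is_derive (x i) t (F i (x true t) (x false t))).
{ intros i t.
  apply is_derive_ext with
    (fun t => x0 i + RInt (fun s => F i (x true s) (x false s)) 0 t).
  { intros s; symmetry; apply limit_integral_equation. }
  replace (F i (x true t) (x false t)) with (0 + F i (x true t) (x false t)) by ring.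
  apply (is_derive_plus (fun _ => x0 i)); [apply (is_derive_const (x0 i) t) |].
  apply (is_derive_RInt_continuous (fun s => F i (x true s) (x false s))).
  intros s; apply continuous_field; apply limit_continuous. }
assert (Hini : forall i, x i 0 = x0 i).
{ intros i; rewrite limit_integral_equation.
  rewrite (RInt_point (V := R_CompleteNormedModule)); apply Rplus_0_r. }
exists (x true), (x false); auto.
Qed.

End Picard.

(** * The energy along the normalised sliding flow *)

(** The witness is the supremum of the times up to which [f] stays below [c]. By continuity,
    [f s < c] would allow a later time, and [f s > c] would already fail just before [s]. *)
Lemma first_crossing (f : R -> R) (a b c : R) :
  (forall t, continuous f t) -> a <= b -> f a < c -> c <= f b ->
  exists s, a < s <= b /\ f s = c /\ forall t, a <= t < s -> f t < c.
Proof.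
intros Hf Hab Ha Hb.
set (P := fun s => a <= s <= b /\ forall t, a <= t <= s -> f t < c).
destruct (completeness P) as [s [Hub Hlub]].
{ exists b; intros s Hs; apply Hs. }
{ exists a; split; [lra |]; intros t Ht; replace t with a by lra; exact Ha. }
assert (Hsa : a <= s).
{ apply Hub; split; [lra |]; intros t Ht; replace t with a by lra; exact Ha. }
assert (Hsb : s <= b) by (apply Hlub; intros r Hr; apply Hr).
assert (Hbelow : forall t, a <= t < s -> f t < c).
{ intros t Ht; apply Rnot_le_lt; intros Hc.
  assert (s <= t); [| lra].
  apply Hlub; intros r [Hr1 Hr2]; apply Rnot_lt_le; intros Hlt.
  specialize (Hr2 t); lra. }
assert (Hnear : forall eps : posreal, exists d : posreal,
          forall t, Rabs (t - s) < d -> Rabs (f t - f s) < eps).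
{ intros eps.
  destruct (proj1 (filterlim_locally _ _) (Hf s) eps) as [d Hd].
  exists d; intros t Ht; now apply Hd. }
assert (Hge : c <= f s).
{ apply Rnot_lt_le; intros Hlt.
  assert (He : 0 < c - f s) by lra.
  destruct (Hnear (mkposreal _ He)) as [[d Hd0] Hd]; simpl in Hd.
  assert (Hne : s <> b) by (intros ->; lra).
  set (r := Rmin b (s + d / 2)).
  assert (s < r) by (unfold r; apply Rmin_glb_lt; lra).
  assert (r <= b) by apply Rmin_l.
  assert (r <= s + d / 2) by apply Rmin_r.
  assert (HP : P r); [| apply Hub in HP; lra].
  split; [lra |]; intros t Ht.
  destruct (Rlt_dec t s) as [Hts | Hts]; [apply Hbelow; lra |].
  specialize (Hd t); rewrite Rabs_pos_eq in Hd by lra.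
  assert (Hd' : Rabs (f t - f s) < c - f s) by (apply Hd; lra).
  apply Rabs_lt_between in Hd'; lra. }
assert (Hs : a < s) by (destruct Hsa as [| ->]; [easy | lra]).
exists s; split; [lra |]; split; [| exact Hbelow].
apply Rle_antisym; [| exact Hge].
apply Rnot_lt_le; intros Hlt.
assert (He : 0 < f s - c) by lra.
destruct (Hnear (mkposreal _ He)) as [[d Hd0] Hd]; simpl in Hd.
set (r := Rmax a (s - d / 2)).
assert (r < s) by (unfold r; apply Rmax_lub_lt; lra).
assert (a <= r) by apply Rmax_l.
assert (s - d / 2 <= r) by apply Rmax_r.
specialize (Hd r); rewrite Rabs_left in Hd by lra.
assert (Hd' : Rabs (f r - f s) < f s - c) by (apply Hd; lra).
apply Rabs_lt_between in Hd'; specialize (Hbelow r); lra.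
Qed.

Lemma last_crossing (f : R -> R) (a b c : R) :
  (forall t, continuous f t) -> a <= b -> c <= f a -> f b < c ->
  exists s, a <= s < b /\ f s = c /\ forall t, s < t <= b -> f t < c.
Proof.
intros Hf Hab Ha Hb.
destruct (first_crossing (fun t => f (- t)) (- b) (- a) c) as [s [Hs [Hfs Hlt]]].
- intros t; apply (continuous_comp (fun t => - t) f); [| apply Hf].
  apply (continuous_opp (V := R_NormedModule) (fun t : R_UniformSpace => t)), continuous_id.
- lra.
- now rewrite Ropp_involutive.
- now rewrite Ropp_involutive.
- exists (- s); split; [lra |]; split; [exact Hfs |].
  intros t Ht; rewrite <- (Ropp_involutive t); apply Hlt; lra.
Qed.

Lemma nonincreasing (f df : R -> R) (a b : R) :
  a <= b -> (forall t, a <= t <= b -> is_derive f t (df t)) ->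
  (forall t, a <= t <= b -> df t <= 0) -> f b <= f a.
Proof.
intros Hab Hd Hneg.
destruct (MVT_gen f a b df) as [c [Hc Heq]]; rewrite ?Rmin_left, ?Rmax_right in * by lra.
- intros t Ht; apply Hd; lra.
- intros t Ht; apply continuity_pt_filterlim.
  apply (ex_derive_continuous f); eexists; now apply Hd.
- specialize (Hneg c Hc); nra.
Qed.

(** This serves at a time when [v] comes back to 1 from below, where it gives the sign of [v']. *)
Lemma derive_left_max (f : R -> R) (a s l : R) :
  a < s -> (forall t, a < t < s -> f t <= f s) -> is_derive f s l -> 0 <= l.
Proof.
intros Has Hmax Hd; apply Rnot_lt_le; intros Hl.
apply is_derive_Reals in Hd.
assert (He : 0 < - l) by lra.
destruct (Hd _ He) as [[d Hd0] Hq]; simpl in Hq.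
set (k := Rmin (d / 2) ((s - a) / 2)).
assert (0 < k) by (unfold k; apply Rmin_glb_lt; lra).
assert (k <= d / 2) by apply Rmin_l.
assert (k <= (s - a) / 2) by apply Rmin_r.
specialize (Hq (- k)); rewrite Rabs_Ropp, Rabs_pos_eq in Hq by lra.
assert (Hq' : Rabs ((f (s + - k) - f s) / - k - l) < - l) by (apply Hq; lra).
apply Rabs_lt_between in Hq'.
specialize (Hmax (s + - k)).
assert (0 <= (f (s + - k) - f s) / - k); [| lra].
replace ((f (s + - k) - f s) / - k) with ((f s - f (s + - k)) / k) by (field; lra).
apply Rdiv_le_0_compat; lra.
Qed.

Lemma exp_le (a b : R) : a <= b -> exp a <= exp b.
Proof.
intros [Hlt | ->]; [left; now apply exp_increasing | apply Rle_refl].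
Qed.

(** If the damping term [- v] is dropped from the numerator of [v'], then [v ^ 2] as a function of
    [u] solves a linear equation with integrating factor [exp (- 6 * u)]. This is the resulting
    first integral; the damping makes it decrease. *)
Definition energy (u v : R) : R := exp (- 6 * u) * (v ^ 2 - 8 * u / 9 - 4 / 27).

(* The sliding flow with time reversed, in the normalised coordinates. *)
Definition flow_on (u v : R -> R) (I : R -> Prop) : Prop :=
  forall t, I t ->
    is_derive u t (3 * v t / (2 - v t)) /\
    is_derive v t (- (8 * u t + v t - 9 * v t ^ 2) / (2 - v t)).

Lemma energy_derive (u v : R -> R) (t : R) :
  v t < 2 ->
  is_derive u t (3 * v t / (2 - v t)) ->
  is_derive v t (- (8 * u t + v t - 9 * v t ^ 2) / (2 - v t)) ->
  is_derive (fun s => energy (u s) (v s)) t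
    (- 2 * v t ^ 2 * exp (- 6 * u t) / (2 - v t)).
Proof.
intros Hv Hu' Hv'; unfold energy.
evar_last.
- auto_derive; [repeat split; eexists; eassumption | reflexivity].
- rewrite (is_derive_unique (fun s : R => u s) t _ Hu'), (is_derive_unique (fun s : R => v s) t _ Hv'); field; lra.
Qed.

Lemma energy_rate_nonpositive (u v : R) :
  v <= 1 -> - 2 * v ^ 2 * exp (- 6 * u) / (2 - v) <= 0.
Proof.
intros Hv; pose proof (exp_pos (- 6 * u)); pose proof (pow2_ge_0 v).
apply Rmult_le_reg_r with (2 - v); [lra |].
unfold Rdiv; rewrite Rmult_assoc, Rinv_l, Rmult_0_l by lra; nra.
Qed.

(** The bound is the value at [u = 1], the minimum of the energy on this half-line. *)
Lemma energy_v1_bound (u : R) : u <= 1 -> - exp (- 6) / 27 <= energy u 1.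
Proof.
intros Hu; unfold energy.
replace (- 6 * u) with (- 6 + 6 * (1 - u)) by ring; rewrite exp_plus.
pose proof (exp_pos (- 6)); pose proof (exp_pos (6 * (1 - u))) as He.
assert (Hk : exp (6 * (1 - u)) * exp (- (6 * (1 - u))) = 1).
{ rewrite <- exp_plus, Rplus_opp_r; apply exp_0. }
pose proof (exp_ineq1_le (- (6 * (1 - u)))).
(* With [s = 6 * (1 - u) >= 0] this reads [exp s * (1 - 4 * s) <= 1], which follows from
   [1 - 4 * s <= 1 - s <= exp (- s)]. *)
assert (-1 <= exp (6 * (1 - u)) * (24 * (1 - u) - 1)) by nra.
nra.
Qed.

(** Since [exp (- 6) <= exp (- 6 * u)] in the strip, the bracket in the energy is at least
    [- 1 / 27], and [4 / 27 - 1 / 27 = 1 / 9]. An orbit with enough energy left to exit is therefore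
    never slow there. *)
Lemma energy_v_bound (u v : R) :
  0 <= u <= 1 -> - exp (- 6) / 27 <= energy u v -> 1 / 9 <= v ^ 2.
Proof.
unfold energy; intros Hu HE.
assert (Hle : exp (- 6) <= exp (- 6 * u)).
{ apply exp_le; lra. }
pose proof (exp_pos (- 6)); nra.
Qed.

Lemma no_return (u v : R -> R) (T : R) :
  (forall t, continuous u t) -> (forall t, continuous v t) ->
  0 < T -> flow_on u v (fun t => 0 <= t <= T) ->
  (forall t, 0 <= t <= T -> v t <= 1) ->
  u 0 = 3 / 2 -> v 0 = 1 -> v T = 1 -> 1 < u T.
Proof.
intros Hcu Hcv HT Hflow Hv u0 v0 vT; apply Rnot_le_lt; intros HuT.
set (E := fun t => energy (u t) (v t)).
assert (HdE : forall t, 0 <= t <= T ->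
          is_derive E t (- 2 * v t ^ 2 * exp (- 6 * u t) / (2 - v t))).
{ intros t Ht; destruct (Hflow t Ht) as [Hu' Hv']; specialize (Hv t Ht).
  apply energy_derive; [lra | easy ..]. }
assert (HE : forall s t, 0 <= s <= t -> t <= T -> E t <= E s).
{ intros s t Hs Ht.
  apply (nonincreasing E (fun t => - 2 * v t ^ 2 * exp (- 6 * u t) / (2 - v t))).
  - easy.
  - intros r Hr; apply HdE; lra.
  - intros r Hr; apply energy_rate_nonpositive, Hv; lra. }
assert (HET : - exp (- 6) / 27 <= E T).
{ unfold E; rewrite vT; now apply energy_v1_bound. }
assert (Hslow : forall t, 0 <= t <= T -> 0 <= u t <= 1 -> 1 / 9 <= v t ^ 2).
{ intros t Ht Hut; apply (energy_v_bound (u t)); [easy |].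
  specialize (HE t T); unfold E in *; lra. }
(* The coordinate [u] falls from [3 / 2] to at most 1, so [u'], and with it [v], is negative
   somewhere. *)
assert (Hneg : exists c, 0 <= c <= T /\ v c < 0).
{ destruct (MVT_gen u 0 T (fun t => 3 * v t / (2 - v t))) as [c [Hc Heq]];
    rewrite ?Rmin_left, ?Rmax_right in * by lra.
  - intros t Ht; apply Hflow; lra.
  - intros t Ht; apply continuity_pt_filterlim, Hcu.
  - exists c; split; [easy |]; apply Rnot_le_lt; intros Hvc.
    specialize (Hv c Hc).
    assert (0 <= 3 * v c / (2 - v c)) by (apply Rdiv_le_0_compat; lra).
    nra. }
destruct Hneg as [c [Hc Hvc]].
(* The time [s2] is the last zero of [v] after [c]. *)
destruct (last_crossing (fun t => - v t) c T 0) as [s2 [Hs2 [Hv2 Hafter]]].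
{ intros t; apply (continuous_opp (V := R_NormedModule) v), Hcv. }
{ lra. } { lra. } { lra. }
(* After [s2] the coordinate [u] does not decrease, so [u s2 <= u T <= 1]; but [v s2 = 0] is
   impossible in the strip [0 <= u <= 1] by [Hslow]. *)
assert (Hu2 : u s2 < 0).
{ assert (Hle : - u T <= - u s2).
  { apply (nonincreasing (fun t => - u t) (fun t => - (3 * v t / (2 - v t)))); [lra | |].
    - intros t Ht; apply (is_derive_opp u), Hflow; lra.
    - intros t Ht.
      assert (0 <= v t) by (destruct (Req_dec t s2) as [-> | Hne];
        [lra | specialize (Hafter t); lra]).
      assert (v t <= 1) by (apply Hv; lra).
      assert (0 <= 3 * v t / (2 - v t)) by (apply Rdiv_le_0_compat; lra); lra. }
  apply Rnot_le_lt; intros H0.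
  specialize (Hslow s2); replace (v s2) with 0 in Hslow by lra; lra. }
(* Between [s1] and [s3] the orbit crosses the strip from [u = 1] to [u = 0]. *)
destruct (last_crossing u 0 s2 1 Hcu) as [s1 [Hs1 [Hu1 Hless]]]; [lra .. |].
destruct (first_crossing (fun t => - u t) s1 s2 0) as [s3 [Hs3 [Hu3 Hmore]]].
{ intros t; apply (continuous_opp (V := R_NormedModule) u), Hcu. }
{ lra. } { lra. } { lra. }
assert (Hband : forall t, s1 <= t <= s3 -> 0 <= u t <= 1).
{ intros t Ht; split.
  - destruct (Req_dec t s3) as [-> | Hne]; [lra | specialize (Hmore t); lra].
  - destruct (Req_dec t s1) as [-> | Hne]; [lra | specialize (Hless t); lra]. }
(* In the strip [Rabs (v t)] is at least [1 / 3], whence [2 * v ^ 2 + 2 / 3 * v >= 0] for either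
   sign of [v], and this sum is nonincreasing. The crossing thus costs at least
   [(1 - exp (- 6)) / 27] of energy. *)
assert (HG : E s3 + / 27 * exp (- 6 * u s3) <= E s1 + / 27 * exp (- 6 * u s1)).
{ apply (nonincreasing (fun t => E t + / 27 * exp (- 6 * u t))
    (fun t => - 2 * v t ^ 2 * exp (- 6 * u t) / (2 - v t)
              + / 27 * (exp (- 6 * u t) * (- 6 * (3 * v t / (2 - v t)))))); [lra | |].
  - intros t Ht; apply (is_derive_plus E); [apply HdE; lra |].
    destruct (Hflow t) as [Hu' _]; [lra |].
    evar_last.
    + auto_derive; [eexists; eassumption | reflexivity].
    + rewrite (is_derive_unique (fun s : R => u s) t _ Hu'); ring.
  - intros t Ht.
    assert (Hv1 : v t <= 1) by (apply Hv; lra).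
    assert (Hv9 : 1 / 9 <= v t ^ 2) by (apply Hslow; [lra | now apply Hband]).
    pose proof (exp_pos (- 6 * u t)) as He.
    replace (_ + _) with
      (- (exp (- 6 * u t) * / (2 - v t) * (2 * v t ^ 2 + 2 / 3 * v t))) by (field; lra).
    assert (0 < / (2 - v t)) by (apply Rinv_0_lt_compat; lra).
    assert (0 <= 2 * v t ^ 2 + 2 / 3 * v t) by nra.
    assert (0 <= exp (- 6 * u t) * / (2 - v t)) by nra.
    nra. }
replace (u s3) with 0 in HG by lra; rewrite Hu1, Rmult_0_r, exp_0, !Rmult_1_r in HG.
assert (E0 : E s1 <= 0).
{ apply Rle_trans with (E 0); [apply HE; lra |].
  unfold E, energy; rewrite u0, v0; pose proof (exp_pos (- 6 * (3 / 2))); nra. }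
assert (E3 : E T <= E s3) by (apply HE; lra).
(* The energy bounds together would give [1 <= 2 * exp (- 6)], against [exp 6 >= 7]. *)
assert (exp 6 * exp (- 6) = 1) by (rewrite <- exp_plus, <- exp_0; f_equal; ring).
pose proof (exp_ineq1_le 6); pose proof (exp_pos (- 6)).
nra.
Qed.

(** * Convergence to the origin by a strict Lyapunov function *)

Lemma exp_quadratic_bounds (s : R) : -6 <= s <= 12 ->
  exp (- 12) * s ^ 2 / 2 <= 1 - (1 + s) * exp (- s) <= exp 6 * s ^ 2 / 2.
Proof.
intros Hs.
(* The derivative of [1 - (1 + s) * exp (- s)] is [s * exp (- s)], compared here with that of
   [K * s ^ 2 / 2]. For [s = 6 * u] this function times [4 / 27] is the part of
   [energy u v + 4 / 27] free of [v], and [-1 <= u <= 2] gives the range of [s]. *)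
assert (Hmvt : forall K, exists c, Rmin 0 s <= c <= Rmax 0 s /\
  1 - (1 + s) * exp (- s) - K * s ^ 2 / 2 = c * (exp (- c) - K) * s).
{ intros K.
  destruct (MVT_gen (fun r => 1 - (1 + r) * exp (- r) - K * r ^ 2 / 2) 0 s
    (fun c => c * (exp (- c) - K))) as [c [Hc Heq]].
  - intros r _; auto_derive; [trivial | field].
  - intros r _; apply continuity_pt_filterlim.
    apply (ex_derive_continuous (fun r => 1 - (1 + r) * exp (- r) - K * r ^ 2 / 2)).
    auto_derive; trivial.
  - exists c; split; [exact Hc |].
    rewrite Ropp_0, exp_0, Rminus_0_r in Heq; lra. }
assert (Hsign : forall c, Rmin 0 s <= c <= Rmax 0 s ->
          0 <= c * s /\ exp (- 12) <= exp (- c) <= exp 6).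
{ intros c; destruct (Rle_dec 0 s).
  - rewrite Rmin_left, Rmax_right by lra; intros Hc.
    split; [nra | split; apply exp_le; lra].
  - rewrite Rmin_right, Rmax_left by lra; intros Hc.
    split; [nra | split; apply exp_le; lra]. }
split.
- destruct (Hmvt (exp (- 12))) as [c [Hc Heq]]; destruct (Hsign c Hc) as [H1 H2]; nra.
- destruct (Hmvt (exp 6)) as [c [Hc Heq]]; destruct (Hsign c Hc) as [H1 H2]; nra.
Qed.

Lemma flow_converges (u v : R -> R) :
  flow_on u v (fun t => 0 <= t) ->
  (forall t, 0 <= t -> -1 <= u t <= 2 /\ -2 <= v t <= 1) ->
  forall eps, 0 < eps -> exists T, forall t, T < t -> Rabs (u t) < eps /\ Rabs (v t) < eps.
Proof.
intros Hflow Hbox.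
set (m := exp (- 12)); set (M := exp 6).
assert (Hm : 0 < m) by apply exp_pos.
assert (HM : m <= M) by (apply exp_le; lra).
(* The cross term [u * v] supplies decay in [u]. Its derivative costs at most [22 * v ^ 2], so this
   choice spends only half of the dissipation [2 * m * v ^ 2]. *)
set (eps0 := m / 22).
set (V := fun t => energy (u t) (v t) + 4 / 27 + eps0 * (u t * v t)).
set (q := fun t => u t ^ 2 + v t ^ 2).
assert (HV : forall t, 0 <= t -> m / 2 * q t <= V t <= 4 * M * q t).
{ intros t Ht; destruct (Hbox t Ht) as [Hu Hv].
  destruct (exp_quadratic_bounds (6 * u t)) as [H1 H2]; [lra |].
  assert (He : m <= exp (- (6 * u t)) <= M) by (split; apply exp_le; lra).
  fold m in H1; fold M in H2.
  unfold V, q, energy, eps0.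
  replace (- 6 * u t) with (- (6 * u t)) by ring.
  set (e := exp (- (6 * u t))) in *.
  assert (m * v t ^ 2 <= e * v t ^ 2 <= M * v t ^ 2) by (split; nra).
  assert (- (m * (u t ^ 2 + v t ^ 2)) <= 2 * (m * (u t * v t)) <= m * (u t ^ 2 + v t ^ 2)).
  { assert (0 <= m * (u t + v t) ^ 2) by (apply Rmult_le_pos; [lra | apply pow2_ge_0]).
    assert (0 <= m * (u t - v t) ^ 2) by (apply Rmult_le_pos; [lra | apply pow2_ge_0]).
    split; lra. }
  assert (0 <= m * u t ^ 2) by nra.
  assert (0 <= m * v t ^ 2) by nra.
  assert (m * u t ^ 2 <= M * u t ^ 2) by nra.
  assert (m * v t ^ 2 <= M * v t ^ 2) by nra.
  split; lra. }
set (dV := fun t => (- 2 * v t ^ 2 * exp (- 6 * u t)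
  + eps0 * (3 * v t ^ 2 - u t * (8 * u t + v t - 9 * v t ^ 2))) / (2 - v t)).
assert (HdV : forall t, 0 <= t -> is_derive V t (dV t)).
{ intros t Ht; destruct (Hbox t Ht) as [Hu Hv]; destruct (Hflow t Ht) as [Hu' Hv'].
  replace (dV t) with
    (- 2 * v t ^ 2 * exp (- 6 * u t) / (2 - v t) + 0 +
     eps0 * (3 * v t / (2 - v t) * v t
             + u t * (- (8 * u t + v t - 9 * v t ^ 2) / (2 - v t))))
    by (unfold dV; field; lra).
  apply (is_derive_plus (fun t => energy (u t) (v t) + 4 / 27)
                        (fun t => eps0 * (u t * v t))).
  - apply (is_derive_plus (fun t => energy (u t) (v t)) (fun _ => 4 / 27)).
    + apply energy_derive; [lra | easy ..].
    + apply (is_derive_const (4 / 27) t).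
  - apply (is_derive_scal (fun t => u t * v t)).
    apply (is_derive_mult u v); [easy | easy | intros x y; apply Rmult_comm]. }
assert (HdVneg : forall t, 0 <= t -> dV t <= - (m / 16) * q t).
{ intros t Ht; destruct (Hbox t Ht) as [Hu Hv].
  assert (He : m <= exp (- 6 * u t)) by (apply exp_le; lra).
  assert (Hq : 0 <= q t) by (unfold q; nra).
  unfold dV; apply Rmult_le_reg_r with (2 - v t); [lra |].
  unfold Rdiv at 1; rewrite (Rmult_assoc _ (/ _)), Rinv_l, Rmult_1_r by lra.
  assert (0 <= m * q t * (2 + v t)) by (apply Rmult_le_pos; [apply Rmult_le_pos |]; lra).
  (* On the box [2 - v t <= 4], which accounts for the passage from [m / 16] to [m / 4]. *)
  apply Rle_trans with (- (m / 4) * q t); [| lra].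
  assert (m * v t ^ 2 <= exp (- 6 * u t) * v t ^ 2) by nra.
  (* The mixed terms are absorbed by [- u * v <= u ^ 2 + v ^ 2 / 4] and
     [9 * u * v ^ 2 <= 18 * v ^ 2]. *)
  assert (3 * v t ^ 2 - u t * (8 * u t + v t - 9 * v t ^ 2)
          <= 22 * v t ^ 2 - 7 * u t ^ 2).
  { pose proof (pow2_ge_0 (u t + v t / 2)); pose proof (pow2_ge_0 (v t)).
    assert (0 <= (2 - u t) * v t ^ 2) by (apply Rmult_le_pos; lra).
    lra. }
  assert (eps0 * (3 * v t ^ 2 - u t * (8 * u t + v t - 9 * v t ^ 2))
          <= eps0 * (22 * v t ^ 2 - 7 * u t ^ 2))
    by (apply Rmult_le_compat_l; [unfold eps0; lra | easy]).
  unfold eps0, q in *; nra. }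
(* The rate is chosen so that [gam * (4 * M) = m / 16], which balances the bounds [HV] and
   [HdVneg]. *)
set (gam := m / (64 * M)).
assert (Hgam : 0 < gam) by (unfold gam; apply Rdiv_lt_0_compat; lra).
assert (Hdecay : forall t, 0 <= t -> V t * exp (gam * t) <= V 0).
{ intros t Ht.
  replace (V 0) with (V 0 * exp (gam * 0)) by (rewrite Rmult_0_r, exp_0; ring).
  apply (nonincreasing (fun t => V t * exp (gam * t))
    (fun t => dV t * exp (gam * t) + V t * (gam * exp (gam * t)))); [easy | |].
  - intros s Hs; apply (is_derive_mult V (fun t => exp (gam * t))).
    + apply HdV; lra.
    + auto_derive; [trivial | ring].
    + intros x y; apply Rmult_comm.
  - intros s Hs.
    specialize (HdVneg s); specialize (HV s); pose proof (exp_pos (gam * s)).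
    assert (gam * V s <= gam * (4 * M * q s)) by (apply Rmult_le_compat_l; lra).
    replace (gam * (4 * M * q s)) with (m / 16 * q s) in * by (unfold gam; field; lra).
    assert (dV s + gam * V s <= 0) by lra.
    nra. }
set (K := 2 / m * V 0).
(* The exponential decay is weakened to decay like [/ (1 + gam * t)], which still gives convergence
   and an explicit [T]. *)
assert (Hq : forall t, 0 <= t -> q t * (1 + gam * t) <= K).
{ intros t Ht; specialize (HV t Ht); specialize (Hdecay t Ht).
  pose proof (exp_ineq1_le (gam * t)).
  assert (0 <= gam * t) by nra.
  assert (0 <= q t) by (unfold q; nra).
  unfold K; apply Rmult_le_reg_l with (m / 2); [lra |].
  replace (m / 2 * (2 / m * V 0)) with (V 0) by (field; lra).
  apply Rle_trans with (V t * exp (gam * t)); [| easy].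
  rewrite <- Rmult_assoc; apply Rmult_le_compat; nra. }
intros eps Heps.
assert (HK : 0 <= K).
{ specialize (Hq 0); assert (0 <= q 0) by (unfold q; nra); lra. }
assert (Hg2 : 0 < gam * eps ^ 2) by (apply Rmult_lt_0_compat, pow_lt; easy).
exists (K / (gam * eps ^ 2)); intros t Ht.
assert (Ht0 : 0 <= t).
{ assert (0 <= K / (gam * eps ^ 2)) by (apply Rdiv_le_0_compat; lra); lra. }
apply Rlt_div_l in Ht; [| easy].
specialize (Hq t Ht0).
assert (Hqe : q t < eps ^ 2).
{ apply Rnot_le_lt; intros Hle; assert (0 <= gam * t) by nra; nra. }
unfold q in Hqe; split; apply Rabs_def1; nra.
Qed.

(** * Global existence of the spiral, by way of a clamped field *)

Definition clamp (a b x : R) : R := Rmax a (Rmin b x).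

Lemma clamp_bounds (a b x : R) : a <= b -> a <= clamp a b x <= b.
Proof.
intros Hab; unfold clamp; split; [apply Rmax_l |].
apply Rmax_lub; [easy | apply Rmin_l].
Qed.

Lemma clamp_id (a b x : R) : a <= x <= b -> clamp a b x = x.
Proof. intros Hx; unfold clamp; rewrite Rmin_right, Rmax_right; lra. Qed.

Lemma clamp_lipschitz (a b x y : R) :
  Rabs (clamp a b x - clamp a b y) <= Rabs (x - y).
Proof.
unfold clamp.
apply Rle_trans with (Rabs (Rmin b x - Rmin b y)).
- generalize (Rmin b x) (Rmin b y); intros p q; unfold Rmax, Rabs.
  destruct (Rle_dec a p), (Rle_dec a q), (Rcase_abs (p - q));
    try match goal with |- context [Rcase_abs ?p] => destruct (Rcase_abs p) end; lra.
- unfold Rmin, Rabs.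
  destruct (Rle_dec b x), (Rle_dec b y), (Rcase_abs (x - y));
    try match goal with |- context [Rcase_abs ?p] => destruct (Rcase_abs p) end; lra.
Qed.

(** Both denominators are at least 1, so dividing does not enlarge the difference of the numerators,
    and changing the denominator costs at most [D * Rabs (v - v')]. *)
Lemma quotient_lipschitz (n n' v v' A D : R) :
  v <= 1 -> v' <= 1 -> Rabs (n - n') <= A -> Rabs n' <= D ->
  Rabs (n / (2 - v) - n' / (2 - v')) <= A + D * Rabs (v - v').
Proof.
intros Hv Hv' HA HD.
assert (Hinv : forall w, w <= 1 -> Rabs (/ (2 - w)) <= 1).
{ intros w Hw; rewrite Rabs_pos_eq by (left; apply Rinv_0_lt_compat; lra).
  rewrite <- Rinv_1; apply Rinv_le_contravar; lra. }
replace (n / (2 - v) - n' / (2 - v'))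
  with ((n - n') * / (2 - v) + n' * (v - v') * (/ (2 - v) * / (2 - v')))
  by (field; lra).
eapply Rle_trans; [apply Rabs_triang |]; rewrite !Rabs_mult.
pose proof (Rabs_pos (n - n')); pose proof (Rabs_pos n'); pose proof (Rabs_pos (v - v')).
pose proof (Hinv v Hv); pose proof (Hinv v' Hv').
pose proof (Rabs_pos (/ (2 - v))); pose proof (Rabs_pos (/ (2 - v'))).
apply Rplus_le_compat; [nra |].
assert (Rabs (/ (2 - v)) * Rabs (/ (2 - v')) <= 1) by nra.
assert (0 <= Rabs n' * Rabs (v - v')) by nra.
apply Rle_trans with (Rabs n' * Rabs (v - v')); nra.
Qed.

(* Clamping to the box [-1, 2] x [-2, 1] makes the field globally Lipschitz. *)
Definition clamped_field (i : bool) (u v : R) : R :=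
  let u := clamp (-1) 2 u in
  let v := clamp (-2) 1 v in
  (if i then 3 * v else - (8 * u + v - 9 * v ^ 2)) / (2 - v).

Lemma clamped_field_bounded (i : bool) (u v : R) : Rabs (clamped_field i u v) <= 60.
Proof.
unfold clamped_field.
pose proof (clamp_bounds (-1) 2 u) as Hu; pose proof (clamp_bounds (-2) 1 v) as Hv.
set (a := clamp (-1) 2 u) in *; set (b := clamp (-2) 1 v) in *.
apply Rabs_le.
split; destruct i; apply Rmult_le_reg_r with (2 - b); try lra;
  unfold Rdiv; rewrite Rmult_assoc, Rinv_l, Rmult_1_r by lra; nra.
Qed.

Lemma clamped_field_lipschitz (i : bool) (u v u' v' : R) :
  Rabs (clamped_field i u v - clamped_field i u' v') <=
  100 * (Rabs (u - u') + Rabs (v - v')).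
Proof.
unfold clamped_field.
pose proof (clamp_lipschitz (-1) 2 u u') as Lu.
pose proof (clamp_lipschitz (-2) 1 v v') as Lv.
pose proof (clamp_bounds (-1) 2 u) as Hu; pose proof (clamp_bounds (-2) 1 v) as Hv.
pose proof (clamp_bounds (-1) 2 u') as Hu'; pose proof (clamp_bounds (-2) 1 v') as Hv'.
set (a := clamp (-1) 2 u) in *; set (b := clamp (-2) 1 v) in *.
set (a' := clamp (-1) 2 u') in *; set (b' := clamp (-2) 1 v') in *.
pose proof (Rabs_pos (u - u')); pose proof (Rabs_pos (v - v')).
eapply Rle_trans.
- apply (quotient_lipschitz _ _ b b' (8 * Rabs (a - a') + 37 * Rabs (b - b')) 54);
    [lra | lra | | apply Rabs_le; destruct i; split; nra].
  pose proof (Rabs_pos (a - a')); pose proof (Rabs_pos (b - b')).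
  destruct i.
  + replace (3 * b - 3 * b') with (3 * (b - b')) by ring.
    rewrite Rabs_mult, Rabs_pos_eq by lra; lra.
  + replace (- (8 * a + b - 9 * b ^ 2) - - (8 * a' + b' - 9 * b' ^ 2))
      with (- 8 * (a - a') + (9 * (b + b') - 1) * (b - b')) by ring.
    eapply Rle_trans; [apply Rabs_triang |]; rewrite !Rabs_mult.
    rewrite (Rabs_left (- 8)) by lra.
    assert (Rabs (9 * (b + b') - 1) <= 37) by (apply Rabs_le; lra).
    nra.
- lra.
Qed.

(** The energy at [(3 / 2, 1)] is negative, which forces [v ^ 2 < 8 * u / 9 + 4 / 27] and so bounds
    [u] from below and [v] on both sides. The side [u = 2] is excluded separately. *)
Lemma sublevel_bounds (u v : R) :
  u <= 2 -> energy u v <= energy (3 / 2) 1 -> -1 < u < 2 /\ -2 < v.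
Proof.
unfold energy; intros Hu HE.
pose proof (exp_pos (- 6 * u)) as He; pose proof (exp_pos (- 6 * (3 / 2))) as He9.
pose proof (pow2_ge_0 v).
assert (Hneg : v ^ 2 - 8 * u / 9 - 4 / 27 < 0).
{ apply Rnot_le_lt; intros Hle; pose proof (Rmult_le_pos _ _ (Rlt_le _ _ He) Hle); lra. }
assert (u < 2); [| split; nra].
destruct Hu as [Hu | ->]; [easy |].
(* At [u = 2] the brackets are [v ^ 2 - 52 / 27] and [- 13 / 27], so the hypothesis would give
   [exp 3 <= 4]. *)
replace (- 6 * (3 / 2)) with (- 6 * 2 + 3) in HE by field.
rewrite exp_plus, Rmult_assoc in HE.
apply Rmult_le_reg_l in HE; [| apply exp_pos].
assert (1 + 3 < exp 3) by (apply exp_ineq1; lra); lra.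
Qed.

Lemma continuous_Rmax (f g : R -> R) (t : R) :
  continuous f t -> continuous g t -> continuous (fun s => Rmax (f s) (g s)) t.
Proof.
intros Hf Hg.
apply continuous_ext with (fun s => / 2 * ((f s + g s) + Rabs (f s - g s))).
{ intros s; unfold Rmax, Rabs.
  destruct (Rle_dec (f s) (g s)), (Rcase_abs (f s - g s)); lra. }
apply (continuous_scal_r (V := R_NormedModule) (/ 2)
         (fun s => (f s + g s) + Rabs (f s - g s))).
apply (continuous_plus (V := R_NormedModule) (fun s => f s + g s)
         (fun s => Rabs (f s - g s))).
- now apply (continuous_plus (V := R_NormedModule) f g).
- apply (continuous_Rabs_comp (fun s => f s - g s)).
  now apply (continuous_minus (V := R_NormedModule) f g).
Qed.

Lemma spiral_exists :
  exists u v : R -> R,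
    u 0 = 3 / 2 /\ v 0 = 1 /\ flow_on u v (fun t => 0 <= t) /\
    (forall t, 0 < t -> v t < 1) /\
    (forall eps, 0 < eps ->
       exists T, forall t, T < t -> Rabs (u t) < eps /\ Rabs (v t) < eps).
Proof.
destruct (planar_ode_solution clamped_field 100 60 (fun i : bool => if i then 3 / 2 else 1))
  as [u [v [u0 [v0 [Hu' Hv']]]]]; [lra | apply clamped_field_bounded |
                                   apply clamped_field_lipschitz |].
assert (Hcu : forall t, continuous u t).
{ intros t; apply (ex_derive_continuous u); eexists; apply Hu'. }
assert (Hcv : forall t, continuous v t).
{ intros t; apply (ex_derive_continuous v); eexists; apply Hv'. }
assert (Hfield : forall t, -1 <= u t <= 2 -> -2 <= v t <= 1 ->
  is_derive u t (3 * v t / (2 - v t)) /\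
  is_derive v t (- (8 * u t + v t - 9 * v t ^ 2) / (2 - v t))).
{ intros t Hu Hv; specialize (Hu' t); specialize (Hv' t).
  unfold clamped_field in Hu', Hv'.
  rewrite (clamp_id (-1) 2 (u t)) in Hv' by easy.
  rewrite (clamp_id (-2) 1 (v t)) in Hu', Hv' by easy.
  now split. }
(* The function [d] is nonpositive exactly on the box and negative exactly in its interior. *)
set (d := fun t => Rmax (Rmax (-1 - u t) (u t - 2)) (Rmax (-2 - v t) (v t - 1))).
assert (Hd : forall t c, d t < c <->
          -1 - u t < c /\ u t - 2 < c /\ -2 - v t < c /\ v t - 1 < c).
{ intros t c; unfold d; rewrite !Rmax_Rlt; tauto. }
assert (Hdle : forall t, d t <= 0 -> -1 <= u t <= 2 /\ -2 <= v t <= 1).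
{ intros t Ht; assert (Hl : forall eps, 0 < eps ->
    -1 - u t < eps /\ u t - 2 < eps /\ -2 - v t < eps /\ v t - 1 < eps).
  { intros eps Heps; apply Hd; lra. }
  repeat split; apply Rnot_lt_le; intros Hlt.
  - specialize (Hl (-1 - u t)); lra.
  - specialize (Hl (u t - 2)); lra.
  - specialize (Hl (-2 - v t)); lra.
  - specialize (Hl (v t - 1)); lra. }
assert (Hcd : forall t, continuous d t).
{ intros t; unfold d; apply continuous_Rmax; apply continuous_Rmax.
  - apply (continuous_minus (V := R_NormedModule) (fun _ => -1) u); [apply continuous_const | easy].
  - apply (continuous_minus (V := R_NormedModule) u (fun _ => 2)); [easy | apply continuous_const].
  - apply (continuous_minus (V := R_NormedModule) (fun _ => -2) v); [apply continuous_const | easy].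
  - apply (continuous_minus (V := R_NormedModule) v (fun _ => 1)); [easy | apply continuous_const]. }
(* The start lies on the side [v = 1], so [d 0 = 0]; there [v' = - 4], and the orbit enters the
   interior at once. *)
assert (Hstart : exists d0, 0 < d0 /\ forall t, 0 < t < d0 -> d t < 0).
{ destruct (Hfield 0) as [_ Hv0]; [lra .. |].
  rewrite u0, v0 in Hv0.
  apply is_derive_Reals in Hv0; destruct (Hv0 1 Rlt_0_1) as [d1 Hd1].
  destruct (proj1 (filterlim_locally _ _) (Hcv 0) (mkposreal _ Rlt_0_1)) as [d3 Hd3].
  assert (Hhalf : 0 < / 2) by lra.
  destruct (proj1 (filterlim_locally _ _) (Hcu 0) (mkposreal _ Hhalf)) as [d4 Hd4].
  exists (Rmin d1 (Rmin d3 d4)); split; [repeat apply Rmin_glb_lt; apply cond_pos |].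
  intros t [Ht0 Ht]; apply Rmin_Rgt in Ht as [Ht1 Ht]; apply Rmin_Rgt in Ht as [Ht3 Ht4].
  assert (Hb : forall dd : posreal, dd > t -> ball 0 dd t).
  { intros dd Hdd; change (Rabs (t - 0) < dd); rewrite Rminus_0_r, Rabs_pos_eq; lra. }
  specialize (Hd3 t (Hb d3 Ht3)); specialize (Hd4 t (Hb d4 Ht4)).
  change (Rabs (v t - v 0) < 1) in Hd3; change (Rabs (u t - u 0) < / 2) in Hd4.
  apply Rabs_lt_between in Hd3, Hd4.
  assert (Hq : Rabs ((v (0 + t) - v 0) / t - - (8 * (3 / 2) + 1 - 9 * 1 ^ 2) / (2 - 1)) < 1).
  { apply Hd1; [lra | rewrite Rabs_pos_eq; lra]. }
  rewrite Rplus_0_l in Hq; apply Rabs_lt_between in Hq.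
  assert (Hq' : (v t - v 0) / t < -1) by lra.
  apply Rlt_div_l in Hq'; [| easy].
  apply Hd; lra. }
destruct Hstart as [d0 [Hd0 Hstart]].
assert (Hflow : forall T, (forall t, 0 <= t <= T -> d t <= 0) ->
          flow_on u v (fun t => 0 <= t <= T)).
{ intros T HT t Ht; apply Hfield; apply Hdle; now apply HT. }
assert (HdInit : d 0 <= 0).
{ unfold d; rewrite u0, v0; repeat apply Rmax_lub; lra. }
assert (Hin : forall t, 0 < t -> d t < 0).
{ intros T HT; apply Rnot_le_lt; intros HdT.
  set (a := Rmin (d0 / 2) T).
  assert (Ha : 0 < a) by (unfold a; apply Rmin_glb_lt; lra).
  assert (a <= d0 / 2) by apply Rmin_l; assert (HaT : a <= T) by apply Rmin_r.
  destruct (first_crossing d a T 0 Hcd HaT) as [s [Hs [Hds Hbefore]]].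
  { apply Hstart; lra. }
  { easy. }
  assert (Hneg : forall t, 0 < t < s -> d t < 0).
  { intros t Ht; destruct (Rlt_dec t a); [apply Hstart; lra | apply Hbefore; lra]. }
  assert (Hle : forall t, 0 <= t <= s -> d t <= 0).
  { intros t Ht; destruct (Req_dec t 0) as [-> | Hne]; [easy |].
    destruct (Req_dec t s) as [-> | Hne']; [lra |]; left; apply Hneg; lra. }
  destruct (Hdle s) as [Hus Hvs]; [lra |].
  assert (HE : energy (u s) (v s) <= energy (3 / 2) 1).
  { rewrite <- u0 at 1; rewrite <- v0.
    apply (nonincreasing (fun t => energy (u t) (v t))
      (fun t => - 2 * v t ^ 2 * exp (- 6 * u t) / (2 - v t))); [lra | |].
    - intros t Ht; destruct (Hdle t (Hle t Ht)); destruct (Hflow s Hle t Ht).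
      apply energy_derive; [lra | easy ..].
    - intros t Ht; destruct (Hdle t (Hle t Ht)).
      now apply energy_rate_nonpositive. }
  (* At the first exit time [s] the energy excludes every side of the box but [v = 1]. *)
  destruct (sublevel_bounds (u s) (v s)) as [Hu1 Hv1]; [lra | easy |].
  assert (Hvs1 : v s = 1).
  { apply Rle_antisym; [lra |]; apply Rnot_lt_le; intros Hlt.
    assert (d s < 0) by (apply Hd; lra); lra. }
  assert (Hus1 : 1 < u s).
  { apply (no_return u v s); try easy; [lra | now apply Hflow |].
    intros t Ht; now apply Hdle, Hle. }
  (* On [v = 1] one has [v' = - 8 * (u - 1)], negative as [1 < u s], although [v] reaches 1 from
     below. *)
  destruct (Hflow s Hle s) as [_ Hder]; [lra |].
  apply (derive_left_max v 0) in Hder; [| lra |].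
  - rewrite Hvs1 in Hder; lra.
  - intros t Ht; rewrite Hvs1; apply Hdle, Hle; lra. }
assert (Hin' : forall t, 0 <= t -> d t <= 0).
{ intros t Ht; destruct (Req_dec t 0) as [-> | Hne]; [easy |]; left; apply Hin; lra. }
assert (Hall : flow_on u v (fun t => 0 <= t)).
{ intros t Ht; apply Hfield; now apply Hdle, Hin'. }
exists u, v; repeat split; try easy; try (now apply Hall).
- intros t Ht; specialize (Hin t Ht); apply Hd in Hin; lra.
- apply flow_converges; [easy |]; intros t Ht; now apply Hdle, Hin'.
Qed.

(** * Trajectories of the piecewise linear field *)

Lemma filterdiff_pair {U V W : NormedModule R_AbsRing} (f : U -> V) (g : U -> W)
  (x : U) (lf : U -> V) (lg : U -> W) :
  filterdiff f (locally x) lf -> filterdiff g (locally x) lg ->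
  filterdiff (fun y => (f y, g y)) (locally x) (fun y => (lf y, lg y)).
Proof.
intros Hf Hg.
apply (filterdiff_comp'_2 f g pair x lf lg pair Hf Hg).
apply (filterdiff_ext_lin _ (fun t => t)); [| now intros []].
apply (filterdiff_ext (fun t => t)); [now intros [] |].
apply filterdiff_id.
Qed.

Lemma is_derive_pair {V W : NormedModule R_AbsRing} (f : R -> V) (g : R -> W)
  (t : R) (lf : V) (lg : W) :
  is_derive f t lf -> is_derive g t lg -> is_derive (fun s => (f s, g s)) t (lf, lg).
Proof.
intros Hf Hg; exact (filterdiff_pair f g t _ _ Hf Hg).
Qed.

Lemma is_derive_fst {V W : NormedModule R_AbsRing} (f : R -> V * W) (t : R) (l : V * W) :
  is_derive f t l -> is_derive (fun s => fst (f s)) t (fst l).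
Proof.
intros Hf.
refine (filterdiff_comp' f (fun p => fst p) t _ (fun p => fst p) Hf _).
apply filterdiff_linear, is_linear_fst.
Qed.

Lemma is_derive_snd {V W : NormedModule R_AbsRing} (f : R -> V * W) (t : R) (l : V * W) :
  is_derive f t l -> is_derive (fun s => snd (f s)) t (snd l).
Proof.
intros Hf.
refine (filterdiff_comp' f (fun p => snd p) t _ (fun p => snd p) Hf _).
apply filterdiff_linear, is_linear_snd.
Qed.

Lemma filterlim_pair_locally {T : Type} {V W : UniformSpace} (F : (T -> Prop) -> Prop)
  {FF : Filter F} (f : T -> V) (g : T -> W) (a : V) (b : W) :
  filterlim f F (locally a) -> filterlim g F (locally b) ->
  filterlim (fun t => (f t, g t)) F (locally (a, b)).
Proof.
intros Hf Hg; apply filterlim_locally; intros eps.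
generalize (filter_and _ _ (proj1 (filterlim_locally _ _) Hf eps)
                           (proj1 (filterlim_locally _ _) Hg eps)).
apply filter_imp; intros t [H1 H2]; now split.
Qed.

Lemma continuous_on_everywhere {V W : UniformSpace} (D : V -> Prop) (f : V -> W) :
  (forall t, continuous f t) -> continuous_on D f.
Proof.
intros Hf t _; apply filterlim_filter_le_1 with (2 := Hf t).
intros P HP; unfold within; revert HP; apply filter_imp; auto.
Qed.

Lemma clamp_continuous (a b t : R) : continuous (clamp a b) t.
Proof.
apply filterlim_locally; intros eps; exists eps; intros s Hs.
eapply Rle_lt_trans; [apply clamp_lipschitz | exact Hs].
Qed.

(* Clamping the time turns the one-sided continuity at the end points into
   continuity on the whole line, as required by [MVT_gen]. *)
Lemma derive_zero_constant (f : R -> R) (a b : R) :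
  continuous_on (fun t => a <= t <= b) f ->
  (forall t, a < t < b -> is_derive f t 0) ->
  forall s t, a <= s <= b -> a <= t <= b -> f t = f s.
Proof.
intros Hc Hd.
assert (Hwlog : forall s t, a <= s -> s <= t -> t <= b -> f t = f s).
{ intros s t Hs Hst Ht; set (g := fun r => f (clamp a b r)).
  assert (Hg : forall r, a <= r <= b -> g r = f r).
  { intros r Hr; unfold g; now rewrite clamp_id. }
  destruct (MVT_gen g s t (fun _ => 0)) as [r [_ Heq]];
    rewrite ?Rmin_left, ?Rmax_right by lra.
  - intros r Hr; apply is_derive_ext_loc with f; [| apply Hd; lra].
    assert (He : 0 < Rmin (r - a) (b - r)) by (apply Rmin_glb_lt; lra).
    exists (mkposreal _ He); intros r' Hr'.
    change (Rabs (r' - r) < Rmin (r - a) (b - r)) in Hr'.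
    apply Rmin_Rgt in Hr' as [H1 H2].
    apply Rgt_lt, Rabs_lt_between in H1; apply Rgt_lt, Rabs_lt_between in H2.
    symmetry; apply Hg; lra.
  - intros r Hr; apply continuity_pt_filterlim; unfold g.
    apply (filterlim_comp _ _ _ (clamp a b) f _
             (within (fun t => a <= t <= b) (locally (clamp a b r)))).
    + intros P HP; generalize (clamp_continuous a b r _ HP).
      unfold filtermap; apply filter_imp; intros r' Hr'; apply Hr', clamp_bounds; lra.
    + apply Hc, clamp_bounds; lra.
  - rewrite !Hg in Heq by lra; lra. }
intros s t Hs Ht; destruct (Rle_dec s t).
- apply Hwlog; lra.
- symmetry; apply Hwlog; lra.
Qed.

(** The supremum of the [s] such that [Q] holds on [[0, s]] is attained by the closing hypothesis,
    and the extension hypothesis forces it to be [T]. It propagates the equality of a trajectory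
    with an orbit of [X]. *)
Lemma real_induction (Q : R -> Prop) (T : R) :
  0 <= T -> Q 0 ->
  (forall s, 0 <= s < T -> (forall t, 0 <= t <= s -> Q t) ->
     exists eps, 0 < eps /\ forall t, s < t < s + eps -> t <= T -> Q t) ->
  (forall s, 0 < s <= T -> (forall t, 0 <= t < s -> Q t) -> Q s) ->
  forall t, 0 <= t <= T -> Q t.
Proof.
intros HT Q0 Hopen Hclosed.
set (P := fun s => 0 <= s <= T /\ forall t, 0 <= t <= s -> Q t).
assert (P0 : P 0).
{ split; [lra |]; intros t Ht; now replace t with 0 by lra. }
destruct (completeness P) as [s [Hub Hlub]].
{ exists T; intros s Hs; apply Hs. }
{ now exists 0. }
assert (Hs0 : 0 <= s) by (now apply Hub).
assert (HsT : s <= T) by (apply Hlub; intros r Hr; apply Hr).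
assert (Hbelow : forall t, 0 <= t < s -> Q t).
{ intros t Ht; apply Classical_Prop.NNPP; intros HQ.
  assert (s <= t); [| lra].
  apply Hlub; intros r [Hr1 Hr2]; apply Rnot_lt_le; intros Hlt; apply HQ, Hr2; lra. }
assert (Hs : forall t, 0 <= t <= s -> Q t).
{ intros t Ht; destruct (Req_dec t s) as [-> | Hne]; [| apply Hbelow; lra].
  destruct (Req_dec s 0) as [-> | Hne]; [easy |]; apply Hclosed; [lra | easy]. }
destruct (Req_dec s T) as [<- | Hne]; [exact Hs |].
destruct (Hopen s) as [eps [Heps Hnext]]; [lra | exact Hs |].
set (r := Rmin T (s + eps / 2)).
assert (s < r) by (unfold r; apply Rmin_glb_lt; lra).
assert (r <= T) by apply Rmin_l.
assert (r <= s + eps / 2) by apply Rmin_r.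
assert (HP : P r); [| apply Hub in HP; lra].
split; [lra |]; intros t Ht.
destruct (Rle_dec t s); [apply Hs; lra | apply Hnext; lra].
Qed.

(** * Lie derivatives, planar foci and differentiability *)

Lemma lie_h (V : R3 -> R3) (xi : R3) : lie V h xi = snd (V xi).
Proof.
destruct xi as [[x y] z]; unfold lie, grad, h; simpl.
rewrite !Derive_const, Derive_id.
destruct (V (x, y, z)) as [[a b] c]; simpl; ring.
Qed.

Lemma lie_ext (V : R3 -> R3) (f g : R3 -> R) (xi : R3) :
  (forall eta, f eta = g eta) -> lie V f xi = lie V g xi.
Proof.
intros Hfg; destruct xi as [[x y] z]; unfold lie, grad.
rewrite (Derive_ext (fun s => f (s, y, z)) (fun s => g (s, y, z))) by easy.
rewrite (Derive_ext (fun s => f (x, s, z)) (fun s => g (x, s, z))) by easy.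
now rewrite (Derive_ext (fun s => f (x, y, s)) (fun s => g (x, y, s))).
Qed.

(** Applying the adjugate of the matrix minus [lambda] to the eigenvector equation gives
    [chi * u = chi * v = 0]. *)
Lemma eigenvalue2_charpoly (a b c d : R) (lambda : C) :
  eigenvalue2 a b c d lambda ->
  (lambda * lambda - RtoC (a + d) * lambda + RtoC (a * d - b * c))%C = RtoC 0.
Proof.
intros [u [v [Hne [H1 H2]]]].
set (chi := (lambda * lambda - RtoC (a + d) * lambda + RtoC (a * d - b * c))%C).
apply Classical_Prop.NNPP; intros Hchi; apply Hne.
assert (Hu : (chi * u)%C = RtoC 0).
{ transitivity ((d - lambda) * ((a * u + b * v) - lambda * u)
                - b * ((c * u + d * v) - lambda * v))%C.
  - unfold chi; rewrite RtoC_plus, RtoC_minus, !RtoC_mult; ring.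
  - rewrite H1, H2; ring. }
assert (Hv : (chi * v)%C = RtoC 0).
{ transitivity ((a - lambda) * ((c * u + d * v) - lambda * v)
                - c * ((a * u + b * v) - lambda * u))%C.
  - unfold chi; rewrite RtoC_plus, RtoC_minus, !RtoC_mult; ring.
  - rewrite H1, H2; ring. }
f_equal; apply Classical_Prop.NNPP; intros Hz.
- now apply (Cmult_neq_0 _ _ Hchi Hz).
- now apply (Cmult_neq_0 _ _ Hchi Hz).
Qed.

Lemma eigenvalue2_focus (a b c d : R) (lambda : C) :
  (a + d) ^ 2 < 4 * (a * d - b * c) -> eigenvalue2 a b c d lambda ->
  Im lambda <> 0 /\ 2 * Re lambda = a + d.
Proof.
intros Hdisc Hl; apply eigenvalue2_charpoly in Hl.
destruct lambda as [p q].
unfold RtoC, Cmult, Cminus, Cplus, Copp in Hl; simpl in Hl; injection Hl as Hre Him.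
simpl.
(* A real root would make [(2 * p - (a + d)) ^ 2] equal to the negative discriminant. The imaginary
   part of the equation then yields [2 * p = a + d]. *)
assert (Hq : q <> 0).
{ intros ->; assert (0 <= (2 * p - (a + d)) ^ 2) by apply pow2_ge_0; nra. }
split; [easy |].
assert (Hprod : q * (2 * p - (a + d)) = 0) by lra.
apply Rmult_integral in Hprod as [|]; [easy | lra].
Qed.

Lemma filterdiff_plane (f dfx : R -> R -> R) (x y a b : R) :
  (forall u v, is_derive (fun s => f s v) u (dfx u v)) ->
  is_derive (f x) y b ->
  continuous (fun w : R2 => dfx (fst w) (snd w)) (x, y) -> dfx x y = a ->
  filterdiff (fun w : R2 => f (fst w) (snd w)) (locally (x, y))
    (fun w : R2 => a * fst w + b * snd w).
Proof.
intros Hx Hy Hc <-.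
apply (filterdiff_ext_lin _ (fun w : R2 => plus (scal (fst w) (dfx x y)) (scal (snd w) b))).
- apply is_derive_filterdiff; [apply filter_forall; intros w; apply Hx | exact Hy | exact Hc].
- intros [u v]; unfold plus, scal; simpl; unfold mult; simpl; ring.
Qed.

Lemma continuous_on_comp {U V W : UniformSpace} (D : U -> Prop) (f : U -> V) (g : V -> W) :
  continuous_on D f -> (forall y, continuous g y) -> continuous_on D (fun t => g (f t)).
Proof.
intros Hf Hg t Ht.
apply (filterlim_comp _ _ _ f g _ (locally (f t))); [now apply Hf | apply Hg].
Qed.

Lemma continuous_on_plus_everywhere (D : R -> Prop) (f g : R -> R) :
  continuous_on D f -> (forall t, continuous g t) -> continuous_on D (fun t => f t + g t).
Proof.
intros Hf Hg t Ht.
apply (filterlim_comp_2 (G := locally (f t)) (H := locally (g t)));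
  [now apply Hf | | apply (filterlim_plus (V := R_NormedModule))].
now apply (continuous_on_everywhere D g Hg).
Qed.

Lemma continuous_on_subset {V W : UniformSpace} (D D' : V -> Prop) (f : V -> W) :
  (forall t, D' t -> D t) -> continuous_on D f -> continuous_on D' f.
Proof.
intros Hsub Hf t Ht; apply filterlim_filter_le_1 with (2 := Hf t (Hsub t Ht)).
intros P HP; unfold within in *; revert HP; apply filter_imp; auto.
Qed.

Section PiecewiseLinear.

Variables alpha beta : R.
Hypothesis alpha_pos : 0 < alpha.
Hypothesis beta_pos : 0 < beta.

(** [X] is tangent to [Sigma] along the line [y = c], and [Yh] has the constant value [mu + c]. *)
Let c := 3 * beta ^ 2 / (8 * alpha).

Lemma c_pos : 0 < c.
Proof.
unfold c; apply Rdiv_lt_0_compat; [| lra].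
apply Rmult_lt_0_compat; [lra | now apply pow_lt].
Qed.

Lemma lie_X (x y z : R) : lie (Xfield alpha beta) h (x, y, z) = y - c.
Proof. apply lie_h. Qed.

Lemma lie_Y (mu : R) (xi : R3) : lie (Yfield alpha beta mu) h xi = mu + c.
Proof. rewrite lie_h; now destruct xi as [[x y] z]. Qed.

Lemma lie_XX (x y z : R) :
  lie (Xfield alpha beta) (lie (Xfield alpha beta) h) (x, y, z) = x - beta.
Proof.
rewrite (lie_ext _ _ (fun eta => snd (fst eta) - c)).
2:{ intros [[x' y'] z']; apply lie_X. }
unfold lie, grad; simpl.
rewrite !Derive_const, (Derive_minus (fun s => s) (fun _ => c)), Derive_id, Derive_const;
  [ring | apply ex_derive_id | apply ex_derive_const].
Qed.

(** Because [Yh] is constant, [Y] has no visible fold, and every visible fold-regular point is a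
    fold of [X]. *)
Lemma lie_YY (mu : R) (xi : R3) :
  lie (Yfield alpha beta mu) (lie (Yfield alpha beta mu) h) xi = 0.
Proof.
rewrite (lie_ext _ _ (fun _ => mu + c)) by (intros eta; apply lie_Y).
destruct xi as [[x y] z]; unfold lie, grad; simpl.
rewrite !Derive_const; ring.
Qed.

Lemma sliding_iff (mu x y z : R) :
  sliding (Zfield alpha beta mu) (x, y, z) <-> z = 0 /\ y < c /\ 0 < mu + c.
Proof.
unfold sliding, Sigma, h; simpl; rewrite lie_X, lie_Y.
split; intros [H1 [H2 H3]]; repeat split; lra.
Qed.

Lemma escaping_iff (mu x y z : R) :
  escaping (Zfield alpha beta mu) (x, y, z) <-> z = 0 /\ c < y /\ mu + c < 0.
Proof.
unfold escaping, Sigma, h; simpl; rewrite lie_X, lie_Y.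
split; intros [H1 [H2 H3]]; repeat split; lra.
Qed.

Lemma sliding_field_eq (mu x y z : R) :
  sliding_field (Zfield alpha beta mu) (x, y, z) =
  (/ (mu + 2 * c - y) * (- alpha * (mu + y)),
   / (mu + 2 * c - y) *
     ((mu + c) * (x - beta) - (y - c) * (3 * alpha / beta * y + beta)),
   0).
Proof.
unfold sliding_field; simpl upper; simpl lower; rewrite lie_X, lie_Y.
replace (mu + c - (y - c)) with (mu + 2 * c - y) by ring.
unfold Xfield, Yfield; fold c.
change (scal (/ (mu + 2 * c - y)) _) with
  (/ (mu + 2 * c - y) * ((mu + c) * (- alpha) + - ((y - c) * alpha)),
   / (mu + 2 * c - y) *
     ((mu + c) * (x - beta) + - ((y - c) * (3 * alpha / beta * y + beta))),
   / (mu + 2 * c - y) * ((mu + c) * (y - c) + - ((y - c) * (mu + c)))).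
f_equal; [f_equal |]; ring.
Qed.

(** * Orbits of [X] and the trajectories that must follow them *)

Definition X_flow (xi : R3) (t : R) : R3 :=
  let '(x, y, z) := xi in
  (x - alpha * t,
   y + (x - beta) * t - alpha * t ^ 2 / 2,
   z + (y - c) * t + (x - beta) * t ^ 2 / 2 - alpha * t ^ 3 / 6).

Lemma X_flow_derive (xi : R3) (t : R) :
  is_derive (X_flow xi) t (Xfield alpha beta (X_flow xi t)).
Proof.
destruct xi as [[x y] z]; unfold X_flow, Xfield; fold c.
repeat apply is_derive_pair; auto_derive; trivial; simpl; field.
Qed.

(** The system is triangular: [x], then [y], then [z] has a derivative already known as a polynomial
    in time, so each differs from its primitive by a constant. *)
Lemma X_trajectory_unique (gamma : R -> R3) (a b : R) :
  continuous_on (fun t => a <= t <= b) gamma ->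
  follows (Xfield alpha beta) gamma (fun t => a < t < b) ->
  forall s t, a <= s <= b -> a <= t <= b -> gamma t = X_flow (gamma s) (t - s).
Proof.
intros Hc Hf s t Hs Ht.
set (x := fun r => fst (fst (gamma r))).
set (y := fun r => snd (fst (gamma r))).
set (z := fun r => snd (gamma r)).
assert (Hg : forall r, gamma r = (x r, y r, z r)).
{ intros r; unfold x, y, z; now destruct (gamma r) as [[? ?] ?]. }
assert (Hd : forall r, a < r < b -> is_derive x r (- alpha) /\
          is_derive y r (x r - beta) /\ is_derive z r (y r - c)).
{ intros r Hr; specialize (Hf r Hr).
  replace (Xfield alpha beta (gamma r)) with (- alpha, x r - beta, y r - c) in Hf
    by now rewrite Hg.
  split; [| split].
  - exact (is_derive_fst _ _ _ (is_derive_fst _ _ _ Hf)).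
  - exact (is_derive_snd _ _ _ (is_derive_fst _ _ _ Hf)).
  - exact (is_derive_snd _ _ _ Hf). }
assert (Cx : continuous_on (fun r => a <= r <= b) x).
{ apply (continuous_on_comp _ gamma (fun p => fst (fst p)) Hc).
  intros p; apply (continuous_comp fst fst); apply continuous_fst. }
assert (Cy : continuous_on (fun r => a <= r <= b) y).
{ apply (continuous_on_comp _ gamma (fun p => snd (fst p)) Hc).
  intros p; apply (continuous_comp fst snd); [apply continuous_fst | apply continuous_snd]. }
assert (Cz : continuous_on (fun r => a <= r <= b) z).
{ apply (continuous_on_comp _ gamma (fun p => snd p) Hc).
  intros p; apply continuous_snd. }
assert (Hrec : forall (f p dp : R -> R), continuous_on (fun r => a <= r <= b) f ->
  (forall r, is_derive p r (dp r)) -> (forall r, a < r < b -> is_derive f r (dp r)) ->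
  p s = f s -> forall r, a <= r <= b -> f r = p r).
{ intros f p dp Cf Hp Hfp Hps r Hr.
  assert (E : f r + - p r = f s + - p s); [| lra].
  apply (derive_zero_constant (fun r => f r + - p r) a b); [| | easy | easy].
  - apply continuous_on_plus_everywhere; [easy |].
    intros r'; apply (continuous_opp (V := R_NormedModule) p).
    apply (ex_derive_continuous p); eexists; apply Hp.
  - intros r' Hr'; replace 0 with (dp r' + - dp r') by ring.
    apply (is_derive_plus f (fun r => - p r)); [now apply Hfp |].
    apply (is_derive_opp p), Hp. }
assert (Ex : forall r, a <= r <= b -> x r = x s - alpha * (r - s)).
{ apply (Hrec x _ (fun _ => - alpha)); [easy | | apply Hd | ring].
  intros r; auto_derive; [trivial | ring]. }
assert (Ey : forall r, a <= r <= b ->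
          y r = y s + (x s - beta) * (r - s) - alpha * (r - s) ^ 2 / 2).
{ apply (Hrec y _ (fun r => x s - alpha * (r - s) - beta)); [easy | | | field].
  - intros r; auto_derive; [trivial | field].
  - intros r Hr; rewrite <- Ex by lra; now apply Hd. }
assert (Ez : forall r, a <= r <= b ->
          z r = z s + (y s - c) * (r - s) + (x s - beta) * (r - s) ^ 2 / 2
                - alpha * (r - s) ^ 3 / 6).
{ apply (Hrec z _ (fun r => y s + (x s - beta) * (r - s) - alpha * (r - s) ^ 2 / 2 - c));
    [easy | | | field].
  - intros r; auto_derive; [trivial | field].
  - intros r Hr; rewrite <- Ey by lra; now apply Hd. }
rewrite (Hg t), (Hg s), Ex, Ey, Ez by easy; reflexivity.
Qed.

Lemma X_flow_0 (xi : R3) : X_flow xi 0 = xi.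
Proof.
destruct xi as [[x y] z]; unfold X_flow; f_equal; [f_equal |]; field.
Qed.

Lemma X_flow_plus (xi : R3) (s t : R) : X_flow (X_flow xi s) t = X_flow xi (s + t).
Proof.
destruct xi as [[x y] z]; unfold X_flow; f_equal; [f_equal |]; field.
Qed.

Lemma follows_X_flow (gamma : R -> R3) (q : R3) (a b : R) :
  (forall t, a < t < b -> gamma t = X_flow q t) ->
  follows (Xfield alpha beta) gamma (fun t => a < t < b).
Proof.
intros Heq t Ht; rewrite Heq by easy.
apply is_derive_ext_loc with (X_flow q); [| apply X_flow_derive].
assert (He : 0 < Rmin (t - a) (b - t)) by (apply Rmin_glb_lt; lra).
exists (mkposreal _ He); intros r Hr.
change (Rabs (r - t) < Rmin (t - a) (b - t)) in Hr.
apply Rmin_Rgt in Hr as [H1 H2].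
apply Rgt_lt, Rabs_lt_between in H1; apply Rgt_lt, Rabs_lt_between in H2.
symmetry; apply Heq; lra.
Qed.

(* As long as the X-orbit of q stays above Sigma, a trajectory of Z which
   leaves q along X has no choice but to follow it. *)
Lemma forward_X_trajectory (mu : R) (gamma : R -> R3) (t0 T : R) :
  let Z := Zfield alpha beta mu in
  0 <= T <= t0 -> trajectory Z gamma 0 t0 ->
  (exists eps, 0 < eps /\ follows (Xfield alpha beta) gamma (fun s => 0 < s < 0 + eps)) ->
  (forall t, 0 < t < T -> h (X_flow (gamma 0) t) > 0) ->
  forall t, 0 <= t <= T -> gamma t = X_flow (gamma 0) t.
Proof.
intros Z HT [Hc [Hfwd _]] Hinit Habove.
assert (Hcont : forall a b, 0 <= a -> b <= t0 -> continuous_on (fun t => a <= t <= b) gamma).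
{ intros a b Ha Hb; apply continuous_on_subset with (2 := Hc); intros t Ht; lra. }
apply real_induction; [lra | now rewrite X_flow_0 | |].
- intros s Hs Hprev.
  assert (Hloc : exists eps, 0 < eps /\
            follows (Xfield alpha beta) gamma (fun r => s < r < s + eps)).
  { destruct (Req_dec s 0) as [-> | Hne]; [exact Hinit |].
    (* Strictly above [Sigma] every clause of [local_forward] other than motion along [X] is
       contradictory. *)
    assert (Hh : h (gamma s) > 0).
    { rewrite Hprev by lra; apply Habove; lra. }
    destruct (Hfwd s) as [eps Heps]; [lra |].
    exists eps; split; [apply cond_pos |].
    cbv zeta in Heps; decompose [or and] Heps; unfold crossing_up, crossing_down, sliding, escaping,
      fold_regular_sliding_X, fold_regular_sliding_Y, fold_regular_escaping,
      fold_regular_escaping_X, fold_regular_escaping_Y, boundary, Sigma in *;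
      try easy; exfalso; intuition lra. }
  destruct Hloc as [eps [Heps Hfol]].
  exists eps; split; [easy |]; intros t Ht HtT.
  rewrite (X_trajectory_unique gamma s t) with (s := s);
    [| apply Hcont; lra | intros r Hr; apply Hfol; lra | lra | lra].
  rewrite Hprev by lra; rewrite X_flow_plus; f_equal; ring.
- intros s Hs Hprev.
  rewrite (X_trajectory_unique gamma 0 s) with (s := 0);
    [now rewrite Rminus_0_r | apply Hcont; lra | | lra | lra].
  apply follows_X_flow with (gamma 0); intros t Ht; apply Hprev; lra.
Qed.

(** The mirror image of the forward case; the induction runs over [r = - t]. *)
Lemma backward_X_trajectory (mu : R) (gamma : R -> R3) (t0 : R) :
  let Z := Zfield alpha beta mu in
  t0 <= 0 -> trajectory Z gamma t0 0 ->
  (exists eps, 0 < eps /\ follows (Xfield alpha beta) gamma (fun s => 0 - eps < s < 0)) ->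
  (forall t, t < 0 -> h (X_flow (gamma 0) t) > 0) ->
  forall t, t0 <= t <= 0 -> gamma t = X_flow (gamma 0) t.
Proof.
intros Z HT [Hc [_ Hbwd]] Hinit Habove.
assert (Hcont : forall a b, t0 <= a -> b <= 0 -> continuous_on (fun t => a <= t <= b) gamma).
{ intros a b Ha Hb; apply continuous_on_subset with (2 := Hc); intros t Ht; lra. }
assert (Hrev : forall r, 0 <= r <= - t0 -> gamma (- r) = X_flow (gamma 0) (- r)).
{ apply real_induction; [lra | now rewrite Ropp_0, X_flow_0 | |].
  - intros s Hs Hprev.
    assert (Hloc : exists eps, 0 < eps /\
              follows (Xfield alpha beta) gamma (fun r => - s - eps < r < - s)).
    { destruct (Req_dec s 0) as [-> | Hne]; [rewrite Ropp_0; exact Hinit |].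
      assert (Hh : h (gamma (- s)) > 0).
      { rewrite Hprev by lra; apply Habove; lra. }
      destruct (Hbwd (- s)) as [eps Heps]; [lra |].
      exists eps; split; [apply cond_pos |].
      cbv zeta in Heps; decompose [or and] Heps; unfold crossing_up, crossing_down, sliding, escaping,
        fold_regular_sliding, fold_regular_sliding_X, fold_regular_sliding_Y,
        fold_regular_escaping_X, fold_regular_escaping_Y, boundary, Sigma in *;
        try easy; exfalso; intuition lra. }
    destruct Hloc as [eps [Heps Hfol]].
    exists eps; split; [easy |]; intros t Ht HtT.
    rewrite (X_trajectory_unique gamma (- t) (- s)) with (s := - s);
      [| apply Hcont; lra | intros r Hr; apply Hfol; lra | lra | lra].
    rewrite Hprev by lra; rewrite X_flow_plus; f_equal; ring.
  - intros s Hs Hprev.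
    rewrite (X_trajectory_unique gamma (- s) 0) with (s := 0);
      [now rewrite Rminus_0_r | apply Hcont; lra | | lra | lra].
    apply follows_X_flow with (gamma 0); intros t Ht.
    rewrite <- (Ropp_involutive t); apply Hprev; lra. }
intros t Ht; rewrite <- (Ropp_involutive t); apply Hrev; lra.
Qed.

(** * Absence of sliding Shilnikov orbits *)

Lemma no_sliding_orbit (mu : R) (p q : R3) (Gamma : R3 -> Prop) :
  mu <> 0 -> ~ shilnikov_orbit_sliding (Zfield alpha beta mu) p q Gamma.
Proof.
intros Hmu [Hp [Hsf [Hq [g1 [g2 [t0 [_ [[Ht0 [Hg0 [Hgt0 [Htraj Hcross]]]] _]]]]]]]].
destruct p as [[px py] pz]; destruct q as [[qx qy] qz].
pose proof Hp as Hp'; rewrite sliding_iff in Hp'; destruct Hp' as [-> [Hpy HM]].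
destruct Hsf as [[_ Heq] _].
rewrite sliding_field_eq in Heq; injection Heq as E1 E2.
assert (HD : / (mu + 2 * c - py) <> 0) by (apply Rinv_neq_0_compat; lra).
apply Rmult_integral in E1 as [|E1]; [easy |].
apply Rmult_integral in E2 as [|E2]; [easy |].
assert (Epy : py = - mu) by nra.
assert (Hfold : qz = 0 /\ qy = c /\ beta < qx).
{ unfold fold_regular_sliding, fold_regular_sliding_X, fold_regular_sliding_Y,
    visible_fold_X, visible_fold_Y, Sigma, h in Hq; simpl in Hq.
  rewrite lie_X, lie_XX, lie_YY in Hq.
  decompose [or and] Hq; [repeat split; lra | lra]. }
destruct Hfold as [-> [-> Hqx]].
set (w := qx - beta).
assert (Hw : 0 < w) by (unfold w; lra).
(* The return time: the height along the orbit has a double zero at 0, because [q] is a tangency,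
   and its third zero at [t1]. *)
set (t1 := 3 * w / alpha).
assert (Ht1 : 0 < t1) by (unfold t1; apply Rdiv_lt_0_compat; lra).
assert (Hheight : forall t, h (X_flow (g2 0) t) = alpha * t ^ 2 * (t1 - t) / 6).
{ intros t; rewrite Hg0; unfold h, X_flow, t1, w; simpl; field; lra. }
set (T := Rmin t0 t1).
assert (HT : 0 < T) by (unfold T; now apply Rmin_glb_lt).
assert (HT0 : T <= t0) by apply Rmin_l; assert (HT1 : T <= t1) by apply Rmin_r.
assert (Hpos : forall t, 0 < t < t1 -> alpha * t ^ 2 * (t1 - t) / 6 > 0).
{ intros t Ht; assert (0 < t ^ 2) by (apply pow_lt; lra).
  apply Rdiv_lt_0_compat; [| lra].
  repeat apply Rmult_lt_0_compat; lra. }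
assert (Hflow : forall t, 0 <= t <= T -> g2 t = X_flow (g2 0) t).
{ apply (forward_X_trajectory mu g2 t0 T); [lra | easy | |].
  - destruct Htraj as [_ [Hfwd _]]; destruct (Hfwd 0) as [eps Heps]; [lra |].
    exists eps; split; [apply cond_pos |].
    rewrite Hg0 in Heps.
    unfold crossing_up, crossing_down, sliding, escaping, fold_regular_sliding_X,
      fold_regular_sliding_Y, fold_regular_escaping, fold_regular_escaping_X,
      fold_regular_escaping_Y, visible_fold_X, visible_fold_Y, h at 1 2 in Heps.
    cbn [upper lower Zfield snd] in Heps.
    rewrite !lie_X, !lie_Y, !lie_XX, !lie_YY in Heps.
    decompose [or and] Heps; try easy; exfalso; lra.
  - intros t Ht; rewrite Hheight; apply Hpos; lra. }
(* If [t0 < t1] the end point is still above [Sigma]; if [t0 > t1] the orbit meets [Sigma] at a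
   sliding point on the way; only [t0 = t1] constrains [mu]. *)
destruct (Rtotal_order t0 t1) as [Hlt | [Heq01 | Hgt]].
- assert (Hh : h (g2 t0) > 0).
  { rewrite Hflow, Hheight; [apply Hpos; lra |].
    unfold T; rewrite Rmin_left; lra. }
  rewrite Hgt0 in Hh; unfold h in Hh; simpl in Hh; lra.
- assert (Hend : g2 t0 = X_flow (g2 0) t1).
  { rewrite <- Heq01; apply Hflow; unfold T; rewrite Rmin_left; lra. }
  rewrite Hgt0, Hg0 in Hend; injection Hend as Ex Ey _.
  assert (Ex' : px = beta - 2 * w) by (rewrite Ex; unfold t1, w; field; lra).
  assert (Ey' : py = c - 3 * w ^ 2 / (2 * alpha))
    by (rewrite Ey; unfold t1, w; field; lra).
  (* The pseudo equilibrium equation at the landing point, once the nonzero factor [py - c] is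
     removed, is this quadratic in [w] up to the factor [- 8 * beta]. *)
  assert (Ew : (2 * w - beta) * (18 * w + 17 * beta) = 0).
  { rewrite Ex' in E2.
    replace (mu + c) with (- (py - c)) in E2 by lra.
    assert (Hfac : (py - c) * (beta - 2 * w + 3 * alpha / beta * py) = 0) by lra.
    apply Rmult_integral in Hfac as [|Hfac]; [lra |].
    rewrite Ey' in Hfac; unfold c in Hfac.
    apply (Rmult_eq_compat_l (- 8 * beta)) in Hfac; rewrite Rmult_0_r in Hfac.
    rewrite <- Hfac; field; lra. }
  apply Rmult_integral in Ew as [Ew | Ew]; [| lra].
  apply Hmu; replace mu with (- py) by lra; rewrite Ey'.
  replace w with (beta / 2) by lra; unfold c; field; lra.
- assert (Hmid : g2 t1 = X_flow (g2 0) t1).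
  { apply Hflow; unfold T; rewrite Rmin_right; lra. }
  assert (HS : Sigma (g2 t1)).
  { unfold Sigma; rewrite Hmid, Hheight; field. }
  destruct (Hcross t1) as [_ Hprod]; [lra | easy |].
  rewrite Hmid, Hg0 in Hprod; simpl in Hprod.
  rewrite lie_X, lie_Y in Hprod.
  replace (c + (qx - beta) * t1 - alpha * (t1 * (t1 * 1)) / 2 - c)
    with (- (3 * w ^ 2 / (2 * alpha))) in Hprod by (unfold t1, w; field; lra).
  assert (0 < 3 * w ^ 2 / (2 * alpha)).
  { apply Rdiv_lt_0_compat; [| lra].
    apply Rmult_lt_0_compat; [lra | now apply pow_lt]. }
  nra.
Qed.

(** For [t < 0] both terms of the height [t ^ 2 * ((qx - beta) / 2 - alpha * t / 6)] are positive,
    whereas [p] lies on [Sigma]. *)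
Lemma no_escaping_orbit (mu : R) (p q : R3) (Gamma : R3 -> Prop) :
  ~ shilnikov_orbit_escaping (Zfield alpha beta mu) p q Gamma.
Proof.
intros [Hp [_ [Hq [g1 [g2 [t0 [_ [[Ht0 [Hg0 [Hgt0 [Htraj _]]]] _]]]]]]]].
destruct p as [[px py] pz]; destruct q as [[qx qy] qz].
rewrite escaping_iff in Hp; destruct Hp as [-> [Hpy HM]].
assert (Hfold : qz = 0 /\ qy = c /\ beta < qx).
{ unfold fold_regular_escaping, fold_regular_escaping_X, fold_regular_escaping_Y,
    visible_fold_X, visible_fold_Y, Sigma, h in Hq; simpl in Hq.
  rewrite lie_X, lie_XX, lie_YY in Hq.
  decompose [or and] Hq; [repeat split; lra | lra]. }
destruct Hfold as [-> [-> Hqx]].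
assert (Hpos : forall t, t < 0 -> h (X_flow (g2 0) t) > 0).
{ intros t Ht; rewrite Hg0.
  replace (h (X_flow (qx, c, 0) t)) with (t ^ 2 * ((qx - beta) / 2 + alpha * - t / 6))
    by (unfold h, X_flow; simpl; field).
  assert (0 < t ^ 2) by nra.
  assert (0 < alpha * - t) by (apply Rmult_lt_0_compat; lra).
  apply Rmult_lt_0_compat; lra. }
assert (Hflow : g2 t0 = X_flow (g2 0) t0).
{ apply (backward_X_trajectory mu g2 t0); [lra | easy | | easy | lra].
  destruct Htraj as [_ [_ Hbwd]]; destruct (Hbwd 0) as [eps Heps]; [lra |].
  exists eps; split; [apply cond_pos |].
  rewrite Hg0 in Heps.
  unfold crossing_up, crossing_down, sliding, escaping, fold_regular_sliding,
    fold_regular_sliding_X, fold_regular_sliding_Y, fold_regular_escaping_X,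
    fold_regular_escaping_Y, visible_fold_X, visible_fold_Y, h at 1 2 in Heps.
  cbn [upper lower Zfield snd] in Heps.
  rewrite !lie_X, !lie_Y, !lie_XX, !lie_YY in Heps.
  decompose [or and] Heps; try easy; exfalso; lra. }
specialize (Hpos t0); rewrite <- Hflow, Hgt0 in Hpos; unfold h in Hpos; simpl in Hpos; lra.
Qed.


(** * The focus and the Shilnikov orbit for [mu = 0] *)

Lemma focus_origin : unstable_hyperbolic_focus (planar_sliding_field (Zfield alpha beta 0)) (0, 0).
Proof.
pose proof c_pos as Hc.
(* As [3 * alpha * c / beta = 9 * beta / 8], the coefficient of [y] reduces to [beta / 8], and the
   constant terms cancel. *)
assert (HF : forall w, planar_sliding_field (Zfield alpha beta 0) w =
  (/ (2 * c - snd w) * (- alpha * snd w),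
   / (2 * c - snd w) * (c * fst w + (beta / 8 - 3 * alpha / beta * snd w) * snd w))).
{ intros [x y]; unfold planar_sliding_field; rewrite sliding_field_eq; simpl.
  replace (0 + 2 * c - y) with (2 * c - y) by ring.
  f_equal; [ring |]; f_equal; unfold c; field; lra. }
split.
{ rewrite HF; simpl; f_equal; ring. }
(* The Jacobian at the origin. Its trace [beta / (16 * c)] is positive, and four times its
   determinant exceeds the squared trace by [95 * alpha ^ 2 / (36 * beta ^ 2)]. *)
exists 0, (- alpha / (2 * c)), (/ 2), (beta / (16 * c)); split.
- apply filterdiff_ext with (1 := fun w => eq_sym (HF w)).
  apply (filterdiff_pair (U := prod_NormedModule _ R_NormedModule R_NormedModule)
    (V := R_NormedModule) (W := R_NormedModule)
    (fun w => / (2 * c - snd w) * (- alpha * snd w))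
    (fun w => / (2 * c - snd w) *
              (c * fst w + (beta / 8 - 3 * alpha / beta * snd w) * snd w))
    (0, 0) (fun w => 0 * fst w + - alpha / (2 * c) * snd w)
    (fun w => / 2 * fst w + beta / (16 * c) * snd w)).
  + apply (filterdiff_plane (fun _ y => / (2 * c - y) * (- alpha * y)) (fun _ _ => 0)).
    * intros x y; apply (is_derive_const (/ (2 * c - y) * (- alpha * y)) x).
    * auto_derive; [lra | field; lra].
    * apply continuous_const.
    * easy.
  + apply (filterdiff_plane
      (fun x y => / (2 * c - y) * (c * x + (beta / 8 - 3 * alpha / beta * y) * y))
      (fun _ y => c * / (2 * c - y))).
    * intros x y; auto_derive; [trivial | ring].
    * auto_derive; [lra | field; lra].
    * apply (continuous_comp snd (fun y => c * / (2 * c - y))); [apply continuous_snd |].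
      apply (ex_derive_continuous (fun y => c * / (2 * c - y))); auto_derive; simpl; lra.
    * field; lra.
- intros lambda Hl; apply eigenvalue2_focus in Hl.
  + destruct Hl as [Him Hre]; split; [easy |].
    assert (0 < beta / (16 * c)) by (apply Rdiv_lt_0_compat; lra); lra.
  + apply Rlt_0_minus.
    replace (4 * (0 * (beta / (16 * c)) - - alpha / (2 * c) * / 2) - (0 + beta / (16 * c)) ^ 2)
      with (95 * alpha ^ 2 / (36 * beta ^ 2)) by (unfold c; field; lra).
    apply Rdiv_lt_0_compat; apply Rmult_lt_0_compat; try lra; now apply pow_lt.
Qed.

Lemma saddle_focus_origin : hyperbolic_pseudo_saddle_focus (Zfield alpha beta 0) (0, 0, 0).
Proof.
pose proof c_pos as Hc.
assert (Hs : sliding (Zfield alpha beta 0) (0, 0, 0)) by (rewrite sliding_iff; lra).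
split; [split; [now left |] | left; split; [easy | apply focus_origin]].
rewrite sliding_field_eq; f_equal; f_equal; ring.
Qed.

Let q0 : R3 := (3 * beta / 2, c, 0).

Lemma fold_regular_q0 : fold_regular_sliding_X (Zfield alpha beta 0) q0.
Proof.
pose proof c_pos as Hc; unfold q0; split; [| split].
- split; [easy |]; split; intros eps.
  + exists (3 * beta / 2, c - eps / 2, 0); split.
    * repeat split; try apply ball_center.
      change (Rabs (c - eps / 2 - c) < eps).
      pose proof (cond_pos eps); rewrite Rabs_left; lra.
    * rewrite sliding_iff; pose proof (cond_pos eps); lra.
  (* The point [q0] itself is on [Sigma] and outside the sliding region, where [y < c] is strict. *)
  + exists (3 * beta / 2, c, 0); split; [apply ball_center |].
    split; [easy |]; rewrite sliding_iff; lra.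
- split; [easy |]; simpl; rewrite lie_X, lie_XX; lra.
- simpl; rewrite lie_Y; lra.
Qed.

Lemma sliding_orbit_exists :
  exists g : R -> R3, g 0 = q0 /\ continuous_on (fun t => t <= 0) g /\
    slides (Zfield alpha beta 0) g (fun t => t < 0) /\
    filterlim g (Rbar_locally m_infty) (locally (0, 0, 0)).
Proof.
pose proof c_pos as Hc.
destruct spiral_exists as [u [v [u0 [v0 [Hflow [Hv Hlim]]]]]].
(* The time scale that turns the normalised flow, run backward, into the sliding field under
   [x = beta * u] and [y = c * v]. *)
set (k := alpha / (3 * beta)).
assert (Hk : 0 < k) by (unfold k; apply Rdiv_lt_0_compat; lra).
set (x := fun t => beta * u (- k * t)); set (y := fun t => c * v (- k * t)).
assert (Hd : forall t, t <= 0 ->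
  is_derive x t (beta * (- k * (3 * v (- k * t) / (2 - v (- k * t))))) /\
  is_derive y t (c * (- k * (- (8 * u (- k * t) + v (- k * t) - 9 * v (- k * t) ^ 2)
                              / (2 - v (- k * t)))))).
{ intros t Ht; destruct (Hflow (- k * t)) as [Hu' Hv']; [nra |].
  assert (Hlin : is_derive (fun s => - k * s) t (- k)) by (auto_derive; [trivial | ring]).
  split.
  - apply (is_derive_scal (fun s => u (- k * s))), (is_derive_comp u (fun s => - k * s)); easy.
  - apply (is_derive_scal (fun s => v (- k * s))), (is_derive_comp v (fun s => - k * s)); easy. }
exists (fun t => (x t, y t, 0)); split; [| split; [| split; [split |]]].
- unfold x, y, q0; rewrite !Rmult_0_r, u0, v0; f_equal; f_equal; field.
- intros t Ht; destruct (Hd t Ht) as [Hx Hy].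
  assert (Hcont : continuous (fun t => (x t, y t, 0)) t).
  { repeat apply (filterlim_pair_locally (locally t)); [| | apply filterlim_const].
    - apply (ex_derive_continuous x); eexists; exact Hx.
    - apply (ex_derive_continuous y); eexists; exact Hy. }
  apply filterlim_filter_le_1 with (2 := Hcont).
  intros P HP; unfold within; revert HP; apply filter_imp; auto.
- intros t Ht; left; rewrite sliding_iff; unfold y.
  specialize (Hv (- k * t)); assert (v (- k * t) < 1) by (apply Hv; nra).
  nra.
- intros t Ht; rewrite sliding_field_eq.
  destruct (Hd t) as [Hx Hy]; [lra |].
  assert (Hv1 : v (- k * t) < 1) by (apply Hv; nra).
  replace (0 + 2 * c - y t) with (c * (2 - v (- k * t))) by (unfold y; ring).
  repeat apply is_derive_pair.
  + evar_last; [exact Hx |]; unfold y.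
    set (b := v (- k * t)) in *; unfold k; field; lra.
  + evar_last; [exact Hy |]; unfold x, y.
    set (a := u (- k * t)) in *; set (b := v (- k * t)) in *; unfold k, c; field; lra.
  + apply (is_derive_const 0 t).
- assert (Hzero : forall (f : R -> R) (m : R), 0 < m ->
    (forall eps, 0 < eps -> exists T, forall t, T < t -> Rabs (f t) < eps) ->
    filterlim (fun t => m * f (- k * t)) (Rbar_locally m_infty) (locally 0)).
  { intros f m Hm Hf; apply filterlim_locally; intros eps.
    destruct (Hf (eps / m)) as [T HT]; [apply Rdiv_lt_0_compat; [apply cond_pos | easy] |].
    exists (- T / k); intros t Ht.
    change (Rabs (m * f (- k * t) - 0) < eps).
    rewrite Rminus_0_r, Rabs_mult, (Rabs_pos_eq m) by lra.
    apply Rlt_div_r in Ht; [| easy].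
    replace (pos eps) with (m * (eps / m)) by (field; lra).
    apply Rmult_lt_compat_l; [easy |]; apply HT; lra. }
  repeat apply (filterlim_pair_locally (Rbar_locally m_infty)); [| | apply filterlim_const].
  + apply Hzero; [easy |]; intros eps Heps; destruct (Hlim eps Heps) as [T HT].
    exists T; apply HT.
  + apply Hzero; [easy |]; intros eps Heps; destruct (Hlim eps Heps) as [T HT].
    exists T; apply HT.
Qed.

Lemma shilnikov_orbit_exists :
  exists Gamma, shilnikov_orbit_sliding (Zfield alpha beta 0) (0, 0, 0) q0 Gamma.
Proof.
pose proof c_pos as Hc.
destruct sliding_orbit_exists as [g1 Hg1].
(* The third zero of the height for [qx - beta = beta / 2], at which the orbit of [X] from [q0]
   lands on the origin. *)
set (t0 := 3 * beta / (2 * alpha)).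
assert (Ht0 : 0 < t0) by (unfold t0; apply Rdiv_lt_0_compat; lra).
set (g2 := X_flow q0).
assert (Hend : g2 t0 = (0, 0, 0)).
{ unfold g2, q0, X_flow, t0, c; f_equal; [f_equal |]; field; lra. }
assert (Hpos : forall t, 0 < t < t0 -> h (g2 t) > 0).
{ intros t Ht.
  replace (h (g2 t)) with (alpha * t ^ 2 * (t0 - t) / 6)
    by (unfold h, g2, q0, X_flow, t0; simpl; field; lra).
  assert (0 < t ^ 2) by (apply pow_lt; lra).
  apply Rdiv_lt_0_compat; [| lra].
  repeat apply Rmult_lt_0_compat; lra. }
assert (Hfol : forall I, follows (Xfield alpha beta) g2 I).
{ intros I t _; apply X_flow_derive. }
exists (fun xi => xi = (0, 0, 0) \/ (exists t, t <= 0 /\ xi = g1 t) \/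
  (exists t, 0 <= t <= t0 /\ xi = g2 t)).
split; [rewrite sliding_iff; lra |].
split; [apply saddle_focus_origin |].
split; [left; apply fold_regular_q0 |].
exists g1, g2, t0; split; [exact Hg1 |]; split; [| intros xi; reflexivity].
split; [easy |]; split; [apply X_flow_0 |]; split; [exact Hend |]; split.
- split; [| split].
  + apply continuous_on_everywhere; intros t.
    apply (ex_derive_continuous g2); eexists; apply X_flow_derive.
  + intros t Ht; exists (mkposreal 1 Rlt_0_1); cbv zeta.
    destruct (Req_dec t 0) as [-> | Hne].
    * unfold g2; rewrite X_flow_0.
      do 6 right; left; split; [apply fold_regular_q0 | apply Hfol].
    * left; split; [apply Hpos; lra | apply Hfol].
  + intros t Ht; exists (mkposreal 1 Rlt_0_1); cbv zeta.
    destruct (Req_dec t t0) as [-> | Hne].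
    (* At the end time the trajectory arrives at a sliding point, which backward in time may be left
       along [X]. *)
    * rewrite Hend; do 5 right; left; split; [rewrite sliding_iff; lra |].
      left; apply Hfol.
    * left; split; [apply Hpos; lra | apply Hfol].
(* The arc stays strictly above [Sigma], so the crossing condition is vacuous. *)
- intros t Ht HS; specialize (Hpos t Ht); unfold Sigma in HS; lra.
Qed.

End PiecewiseLinear.

Theorem theorem3 (alpha beta : R) (alpha_pos : 0 < alpha) (beta_pos : 0 < beta) :
  let p0 : R3 := (0, 0, 0) in
  let q0 : R3 := (3 * beta / 2, 3 * beta ^ 2 / (8 * alpha), 0) in
  (hyperbolic_pseudo_saddle_focus (Zfield alpha beta 0) p0 /\
   unstable_hyperbolic_focus (planar_sliding_field (Zfield alpha beta 0)) (fst p0) /\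
   visible_fold_regular (Zfield alpha beta 0) q0 /\
   exists Gamma : R3 -> Prop,
     sliding_shilnikov_orbit (Zfield alpha beta 0) p0 q0 Gamma) /\
  (forall mu : R, mu <> 0 ->
     ~ admits_sliding_shilnikov_orbit (Zfield alpha beta mu)).
Proof.
intros p0 q0; split.
- split; [now apply saddle_focus_origin |].
  split; [now apply focus_origin |].
  split; [left; left; now apply fold_regular_q0 |].
  destruct (shilnikov_orbit_exists alpha beta alpha_pos beta_pos) as [Gamma HGamma].
  exists Gamma; now left.
- intros mu Hmu [p [q [Gamma [Horb | Horb]]]].
  + now apply no_sliding_orbit in Horb.
  + now apply no_escaping_orbit in Horb.
Qed.
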